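(* Let $f=x^6+y^6+x^4zt+z^3\in\mathbb{Q}[x,y,z,t]$ and let $$J=\langle x^4t+3z^2,\ x^4z,\ y^5,\ 3x^5+2x^3zt\rangle\subset\mathbb{Q}[x,y,z,t]$$ be its Jacobian ideal, i.e. the ideal generated by the partial derivatives of $f$. Then $J$ is a primary ideal, while its integral closure $$\begin{aligned}\bar J=\langle\, &3x^2yz+2yz^2t,\ 3x^3z+2xz^2t,\ x^4t+3z^2,\ y^4z,\ x^4z,\ y^5,\ 3x^2y^3+2y^3zt,\ 3x^3y^2+2xy^2zt,\\ &9x^4y-4yz^2t^2,\ 3x^5+2x^3zt,\ x^3yzt,\ x^4y^2,\ 4y^3zt^3+27y^3z,\ xy^3zt^2,\ 2x^3y^2t^2-9xy^2z,\ 4xy^4t^3+27xy^4\,\rangle\end{aligned}$$ is not primary. The associated primes of $\bar J$ are $\langle z,y,x\rangle$ and $\langle z,y,x,4t^3+27\rangle$.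
   Context: For an ideal $I$ of a commutative ring $R$, an element $r\in R$ is integral over $I$ if there exist an integer $m\ge 1$ and elements $a_i\in I^i$, $i=1,\dots,m$, such that $r^m+a_1r^{m-1}+\cdots+a_{m-1}r+a_m=0$. The integral closure $\bar I$ of $I$ is the set of all elements of $R$ integral over $I$. The associated primes of an ideal $I\subset R$ are the associated primes of the $R$-module $R/I$. *)

(* Defs.v *)
From mathcomp Require Import all_boot all_algebra ring_quotient.
From mathcomp Require Import boolp mpoly.

Set Implicit Arguments.
Unset Strict Implicit.
Unset Printing Implicit Defensive.

Import GRing.Theory.
Local Open Scope ring_scope.

(* Ideals are collective predicates [{pred R}], as in ring_quotient, made     *)
(* boolean with [asbool] and compared extensionally with [=i].                *)

Definition ideal_gen (R : comNzRingType) (A : {pred R}) : {pred R} :=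
  [pred r | `[< exists s : seq (R * R),
                  (forall p, p \in s -> p.2 \in A)
                  /\ r = \sum_(p <- s) p.1 * p.2 >]].

Definition seq_ideal (R : comNzRingType) (s : seq R) : {pred R} :=
  ideal_gen (mem s).

(* For n = 0 the only product is the empty one, so I^0 is the unit ideal.     *)
Definition ideal_exp (R : comNzRingType) (I : {pred R}) (n : nat) : {pred R} :=
  ideal_gen [pred r | `[< exists s : n.-tuple R,
                            {subset s <= I} /\ r = \prod_(a <- s) a >]].

Definition integral_over_ideal (R : comNzRingType) (I : {pred R}) (r : R) :
    Prop :=
  exists (m : nat) (a : nat -> R),
    [/\ (1 <= m)%N,
        forall i, (1 <= i <= m)%N -> a i \in ideal_exp I i
      & r ^+ m + \sum_(1 <= i < m.+1) a i * r ^+ (m - i) = 0].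

Definition integral_closure (R : comNzRingType) (I : {pred R}) : {pred R} :=
  [pred r | `[< integral_over_ideal I r >]].

(* [idealr_closed] includes properness (1 \notin I).                          *)
Definition prime_ideal (R : comNzRingType) (P : {pred R}) : Prop :=
  idealr_closed P /\ prime_idealr_closed P.

Definition primary_ideal (R : comNzRingType) (Q : {pred R}) : Prop :=
  idealr_closed Q /\
  forall a b : R, a * b \in Q -> a \in Q \/ exists n : nat, b ^+ n \in Q.

(* The annihilator of the class of m in the R-module R/I: r kills this class  *)
(* exactly when r * m lies in I.                                              *)
Definition quot_ann (R : comNzRingType) (I : {pred R}) (m : R) : {pred R} :=
  [pred r | r * m \in I].

Definition associated_prime (R : comNzRingType) (I P : {pred R}) : Prop :=
  prime_ideal P /\ exists m : R, P =i quot_ann I m.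

Definition jacobian_ideal (R : comNzRingType) (n : nat) (f : {mpoly R[n]}) :
    {pred {mpoly R[n]}} :=
  seq_ideal (R := {mpoly R[n]}) [seq mderiv i f | i <- enum 'I_n].

(* Main.v *)
Require Import Defs.
From HB Require Import structures.
From mathcomp Require Import all_boot all_order all_algebra all_field ring_quotient.
From mathcomp Require Import boolp mpoly.
From mathcomp Require Import ring zify.

(* Write [g = x^4 t + 3 z^2], [q = 3 x^2 + 2 z t], [p = 4 t^3 + 27], and [K] for  *)
(* the ideal with the sixteen generators.                                        *)
(*   [K] is integral over [J]: the elements of degree [n] of the integral closure *)
(* of the Rees algebra of [J] form a module closed under taking roots, and each  *)
(* generator has a square or a fifth power that decomposes suitably, for example *)
(* [(x y^2 q)^5 = (y^5)^2 (x^3 q) (x q^2)^2].                                    *)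
(*   Conversely, on [z = x^2 u], [t = - 3 u^2], which parametrises [g = 0], the   *)
(* ideal [J] has order 5 along [x = y = 0]; and along [x = s^5], [y = s^6],      *)
(* [u = c + s^5] with [2 c^3 = 1], a point of [p = 0], it has order 30. Orders   *)
(* pass to integral elements. Modulo [g] every polynomial is [A + z B] with [A], *)
(* [B] in [Q[t][x, y]]; order 5 forces it into the five cyclic torsion pieces    *)
(* [x^(3 - j) y^j z] ([j < 4]) and [x y^4], each isomorphic to [Q[t] / (p)]      *)
(* modulo [K], and order 30 makes these five components vanish.                  *)
(*   The same normal form shows that the ring modulo [J] is torsion free over    *)
(* [Q[t]], whence [J] is primary, and that the torsion of the ring modulo [K] is *)
(* killed by [p], whence the associated primes.                                  *)

Set Implicit Arguments.
Unset Strict Implicit.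
Unset Printing Implicit Defensive.

Import GRing.Theory Num.Theory.
Local Open Scope ring_scope.

(** * Ideals, orders and the Rees algebra *)

(** The inclusion of [KK] in the closure is [Kgens_integral]. For the reverse one, [integral_ord_ge]
    turns integrality into bounds on orders, and [order5_rows] with [ord30_rows] shows that orders 5
    and 30 force membership ([K_of_orders]); [integral_closureJ] joins both.

    Modulo nilpotents of the ring modulo J every element is a polynomial in t, and [J_torsionfree]
    makes the nonzero ones nonzerodivisors, so J is primary. Modulo K there is torsion, and
    [K_torsion] says that p kills it: x y^4 is a torsion class with annihilator (x, y, z, p), while
    p y^4 has annihilator (x, y, z). Any associated prime contains x, y, z and meets Q[t] either in
    0 or in a prime containing the irreducible p. *)

Definition ideal_pred (R : comNzRingType) (I : {pred R}) : Prop :=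
  [/\ 0 \in I, forall a b, a \in I -> b \in I -> a + b \in I
    & forall a b, b \in I -> a * b \in I].

Section Ideals.
Variable R : comNzRingType.
Implicit Types (A I : {pred R}) (r : R).

Lemma ideal_genP A r :
  reflect (exists s : seq (R * R), (forall p, p \in s -> p.2 \in A)
             /\ r = \sum_(p <- s) p.1 * p.2)
          (r \in ideal_gen A).
Proof. exact: asboolP. Qed.

Lemma ideal_gen_ideal A : ideal_pred (ideal_gen A).
Proof.
split.
- by apply/ideal_genP; exists [::]; rewrite big_nil; split.
- move=> a b /ideal_genP[s [sA ->]] /ideal_genP[u [uA ->]].
  apply/ideal_genP; exists (s ++ u); rewrite big_cat; split=> // p.
  by rewrite mem_cat => /orP[/sA|/uA].
- move=> a b /ideal_genP[s [sA ->]]; apply/ideal_genP.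
  exists [seq (a * p.1, p.2) | p <- s]; split=> [p /mapP[p' /sA ? ->] //|].
  by rewrite big_map mulr_sumr; apply: eq_bigr => p _; rewrite mulrA.
Qed.

Lemma ideal_sum I (T : Type) (s : seq T) (P : pred T) (F : T -> R) :
  ideal_pred I -> (forall i, P i -> F i \in I) ->
  \sum_(i <- s | P i) F i \in I.
Proof. by case=> I0 ID _ FI; elim/big_ind: _. Qed.

Lemma idealN I r : ideal_pred I -> r \in I -> - r \in I.
Proof. by case=> _ _ IM rI; rewrite -mulN1r IM. Qed.

Lemma idealB I a b : ideal_pred I -> a \in I -> b \in I -> a - b \in I.
Proof. by move=> iI aI bI; case: (iI) => _ ID _; rewrite ID ?idealN. Qed.

Lemma ideal_gen_min A I :
  ideal_pred I -> {subset A <= I} -> {subset ideal_gen A <= I}.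
Proof.
move=> iI AI _ /ideal_genP[s [sA ->]]; rewrite big_seq; apply: ideal_sum => // p.
by case: iI => _ _ IM /sA/AI; apply: IM.
Qed.

Lemma seq_ideal_ind (s : seq R) (P : R -> Prop) :
  P 0 -> (forall a b, P a -> P b -> P (a + b)) ->
  (forall a b, P b -> P (a * b)) -> (forall a, a \in s -> P a) ->
  forall r, r \in seq_ideal s -> P r.
Proof.
move=> P0 PD PM Ps _ /ideal_genP[u [us ->]]; rewrite big_seq.
by elim/big_ind: _ => // p /us/Ps; apply: PM.
Qed.

Lemma seq_idealW (s : seq R) r : r \in seq_ideal s ->
  exists2 u : seq (R * R), forall p, p \in u -> p.2 \in s
    & r = \sum_(p <- u) p.1 * p.2.
Proof. by case/ideal_genP=> u [us ->]; exists u. Qed.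

Lemma mem_ideal_gen A : {subset A <= ideal_gen A}.
Proof.
move=> r rA; apply/ideal_genP; exists [:: (1, r)]; rewrite big_seq1 mul1r.
by split=> // p /[!inE] /eqP->.
Qed.

(** Each binomial term contains b to a power at least l or a to a power at least k. *)
Lemma ideal_add_exp I a b k l :
  ideal_pred I -> a ^+ k \in I -> b ^+ l \in I -> (a + b) ^+ (k + l) \in I.
Proof.
move=> iI aI bI; case: (iI) => I0 _ IM.
rewrite exprDn; apply: ideal_sum => // i _; rewrite -mulr_natl; apply: (IM).
have [li|/ltnW il] := leqP l i.
  have -> : b ^+ i = b ^+ (i - l) * b ^+ l by rewrite -exprD subnK.
  by rewrite mulrA; apply: IM.
have -> : (k + l - i = l - i + k)%N by rewrite -addnBA // addnC.
by rewrite exprD mulrAC; apply: IM.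
Qed.

Lemma ideal_exp_ideal I n : ideal_pred (ideal_exp I n).
Proof. exact: ideal_gen_ideal. Qed.

Lemma ideal_exp0 I r : r \in ideal_exp I 0.
Proof.
rewrite -[r]mulr1; have [_ _] := ideal_exp_ideal I 0; apply.
by apply/mem_ideal_gen/asboolP; exists [tuple]; rewrite big_nil.
Qed.

Lemma ideal_expS I n a b :
  a \in I -> b \in ideal_exp I n -> a * b \in ideal_exp I n.+1.
Proof.
move=> aI; have [E0 ED EM] := ideal_exp_ideal I n.+1.
move=> bI; have := @ideal_gen_min _ [pred b | a * b \in ideal_exp I n.+1] _ _ b bI.
apply.
  split; rewrite ?inE ?mulr0 // => c d; rewrite !inE ?mulrDr; first exact: ED.
  by rewrite mulrCA; apply: EM.
move=> c /asboolP[s [sI ->]]; rewrite inE; apply/mem_ideal_gen/asboolP.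
exists [tuple of a :: s]; split; last by rewrite big_cons.
by move=> d /[!inE] /predU1P[->|/sI].
Qed.

Lemma ideal_exp_min (M : nat -> {pred R}) I :
  (forall n, ideal_pred (M n)) -> 1 \in M 0 ->
  (forall n a b, a \in I -> b \in M n -> a * b \in M n.+1) ->
  forall n, {subset ideal_exp I n <= M n}.
Proof.
move=> iM M0 MS n; apply: ideal_gen_min => // r /asboolP[s [sI ->]].
elim: n s sI => [|n IHn] s sI; first by rewrite tuple0 big_nil.
case/tupleP: s sI => a s sI; rewrite big_cons; apply: MS.
  by apply: sI; rewrite inE eqxx.
by apply: IHn => d ds; apply: sI; rewrite inE ds orbT.
Qed.

End Ideals.

Lemma mpoly_ring_ind (R : comNzRingType) (n : nat) (P : {mpoly R[n]} -> Prop) :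
  (forall c, P c%:MP) -> (forall p q, P p -> P q -> P (p + q)) ->
  (forall i p, P p -> P ('X_i * p)) -> forall p, P p.
Proof.
move=> PC PD PX p; rewrite [p]mpolyE; elim/big_ind: _ => // [|m _].
  by rewrite -mpolyC0.
rewrite -mul_mpolyC mulrC mpolyXE_id.
elim: (index_enum _) => [|i s IHs]; first by rewrite big_nil mul1r.
rewrite big_cons -mulrA; elim: (m i) => [|k IHk]; first by rewrite mul1r.
by rewrite exprS -mulrA; apply: PX.
Qed.

Section Orders.
Variable S : idomainType.
Implicit Types f g : {poly S}.

Definition ord_ge (n : nat) f : Prop := exists g, f = g * 'X^n.

Lemma ord_geP n f : ord_ge n f <-> forall i, (i < n)%N -> f`_i = 0.
Proof.
split=> [[g ->] i ltin|f0]; first by rewrite coefMXn ltin.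
exists (drop_poly n f); rewrite -{1}[f](poly_take_drop n).
suff -> : take_poly n f = 0 by rewrite add0r.
by apply/polyP=> i; rewrite coef_take_poly coef0; case: ifP => // /f0.
Qed.

Lemma ord_geD n f g : ord_ge n f -> ord_ge n g -> ord_ge n (f + g).
Proof. by move=> [a ->] [b ->]; exists (a + b); rewrite mulrDl. Qed.

Lemma ord_geM m n f g : ord_ge m f -> ord_ge n g -> ord_ge (m + n) (f * g).
Proof. by move=> [a ->] [b ->]; exists (a * b); rewrite exprD; ring. Qed.

Lemma ord_ge0 f : ord_ge 0 f.
Proof. by exists f; rewrite expr0 mulr1. Qed.

Lemma ord_ge_ideal (R : comNzRingType) (phi : {rmorphism R -> {poly S}}) n :
  ideal_pred [pred r : R | `[< ord_ge n (phi r) >]].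
Proof.
split=> [|a b /asboolP aI /asboolP bI|a b /asboolP bI]; apply/asboolP.
- by exists 0; rewrite rmorph0 mul0r.
- by rewrite rmorphD; apply: ord_geD.
- by rewrite rmorphM; apply: (@ord_geM 0) => //; apply: ord_ge0.
Qed.

Lemma ord_ge_rmorph (R : comNzRingType) (phi : {rmorphism R -> {poly S}}) n
    (s : seq R) :
  (forall a, a \in s -> ord_ge n (phi a)) ->
  forall r, r \in seq_ideal s -> ord_ge n (phi r).
Proof.
move=> s_n r rs; apply/asboolP; move: r rs.
apply: (ideal_gen_min (ord_ge_ideal phi n)) => a /s_n a_n; exact/asboolP.
Qed.

(** If [phi r] had order k < e, then r^m would have order exactly k m, as [S] is a domain, while
    each a_i r^(m - i) has order at least e i + k (m - i) > k m; the equation could not balance in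
    degree k m. *)
Lemma integral_ord_ge (R : comNzRingType) (phi : {rmorphism R -> {poly S}})
    (I : {pred R}) (e : nat) (r : R) :
  (forall a, a \in I -> ord_ge e (phi a)) -> integral_over_ideal I r ->
  ord_ge e (phi r).
Proof.
move=> phiI [m [a [m_gt0 aI]]] /(congr1 phi).
rewrite rmorph0 rmorphD rmorphXn rmorph_sum => /= eq0.
apply/ord_geP => i lt_ie; apply/eqP/negPn/negP=> nz.
have ex : exists i, (phi r)`_i != 0 by exists i.
case: (ex_minnP ex) => k nzk kmin.
have {i lt_ie nz ex}ltke : (k < e)%N by apply: leq_ltn_trans lt_ie; apply: kmin.
have [rho def_rho] : ord_ge k (phi r).
  by apply/ord_geP => i; apply: contraTeq => /kmin; rewrite -leqNgt.
have expI n b : b \in ideal_exp I n -> ord_ge (e * n) (phi b).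
  move=> bI; apply/asboolP; move: b bI.
  apply: (@ideal_exp_min _ (fun n => [pred b | `[< ord_ge (e * n) (phi b) >]])).
  - by move=> l; apply: ord_ge_ideal.
  - by apply/asboolP; rewrite muln0; apply: ord_ge0.
  - move=> l b c bI /asboolP cI; apply/asboolP.
    by rewrite mulnS rmorphM; apply: ord_geM => //; apply: phiI.
have /ord_geP/(_ (k * m)%N (ltnSn _)) :
    ord_ge (k * m).+1 (\sum_(1 <= i < m.+1) phi (a i * r ^+ (m - i))).
  rewrite big_nat_cond; apply: (big_ind (ord_ge _)) => [||i].
  - by exists 0; rewrite mul0r.
  - exact: ord_geD.
  rewrite andbT ltnS => /andP[i0 im].
  have [b def_b] : ord_ge (e * i) (phi (a i)) by apply/expI/aI; rewrite i0.
  rewrite rmorphM rmorphXn def_b def_rho exprMn -exprM mulrACA -exprD.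
  have le : (k * m < e * i + k * (m - i))%N.
    by rewrite -{1}(subnKC im) mulnDr ltn_add2r ltn_mul2r i0.
  by exists (b * rho ^+ (m - i) * 'X^(e * i + k * (m - i) - (k * m).+1));
     rewrite -[RHS]mulrA -exprD subnK.
(* Only r^m contributes in this degree, with the m-th power of the leading coefficient [rho](0),
   which is nonzero. *)
move: eq0 => /(congr1 (fun f : {poly S} => f`_(k * m))).
rewrite coefD coef0 => + B0; rewrite [X in _ + X = _]B0 addr0 def_rho exprMn -exprM
  coefMXn ltnn subnn.
rewrite -horner_coef0 horner_exp horner_coef0 => /eqP.
rewrite expf_eq0 m_gt0 /=; apply/negP.
by move: nzk; rewrite def_rho coefMXn ltnn subnn.
Qed.
End Orders.

Lemma mem_seq_nth (T : eqType) (x0 : T) (s : seq T) (P : T -> Prop) :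
  (forall i, (i < size s)%N -> P (nth x0 s i)) -> forall a, a \in s -> P a.
Proof. by move=> H a a_s; rewrite -(nth_index x0 a_s); apply: H; rewrite index_mem. Qed.

Section Rees.
Variables (R : comNzRingType) (s : seq R).
Let k := size s.
Let j (i : 'I_k) := s`_i.

(** The image of this morphism, sending the i-th variable to the i-th generator times T, is the Rees
    algebra of the ideal; integrality over the map is integrality over that image. *)
Definition rees : {mpoly R[k]} -> {poly R} := mmap (@polyC R) (fun i => j i *: 'X).
HB.instance Definition _ := GRing.RMorphism.on rees.

Lemma coef_rees b i : (rees b)`_i \in ideal_exp (seq_ideal s) i.
Proof.
elim/mpoly_ring_ind: b i => [c|p q IHp IHq|i p IHp] l.
- rewrite /rees mmapC coefC; case: eqP => [->|_]; first exact: ideal_exp0.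
  by case: (ideal_exp_ideal (seq_ideal s) l).
- rewrite rmorphD coefD.
  by case: (ideal_exp_ideal (seq_ideal s) l) => _ ED _; apply: ED.
rewrite rmorphM /= {1}/rees mmapX mmap1U -scalerAl coefZ coefXM.
case: l => [|l] /=; first exact: ideal_exp0.
by apply: ideal_expS => //; apply: mem_ideal_gen; apply: mem_nth.
Qed.

(* [r] is integral over the [n]-th power of the ideal, expressed by the degree [n] *)
(* element [r T^n] being integral over the Rees algebra.                        *)
Definition int_over (n : nat) (r : R) : Prop := integralOver rees (r *: 'X^n).

Lemma int_overD n a b : int_over n a -> int_over n b -> int_over n (a + b).
Proof. by rewrite /int_over scalerDl; apply: integral_add. Qed.

Lemma int_overM m n a b : int_over m a -> int_over n b -> int_over (m + n) (a * b).
Proof.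
move=> ia ib; rewrite /int_over exprD -scalerA scalerAr scalerAl.
exact: integral_mul.
Qed.

Lemma int_over_const a : int_over 0 a.
Proof.
suff def_a : a *: 'X^0 = rees a%:MP by rewrite /int_over def_a; apply: integral_id.
by rewrite /rees mmapC alg_polyC.
Qed.

Lemma int_overMl n a b : int_over n b -> int_over n (a * b).
Proof. by move=> ib; apply: (@int_overM 0) => //; apply: int_over_const. Qed.

Lemma int_over_gen a : a \in s -> int_over 1 a.
Proof.
move=> a_s; have lt_i : (index a s < k)%N by rewrite index_mem.
have -> : a = j (Ordinal lt_i) by rewrite /j nth_index.
suff def_j : j (Ordinal lt_i) *: 'X^1 = rees 'X_(Ordinal lt_i).
  by rewrite /int_over def_j; apply: integral_id.
by rewrite /rees mmapX mmap1U.
Qed.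

Lemma int_over0 n : int_over n 0.
Proof. by rewrite /int_over scale0r; apply: integral0. Qed.

Lemma int_over_seq a : a \in seq_ideal s -> int_over 1 a.
Proof.
case/ideal_genP=> u [us ->]; rewrite big_seq.
elim/big_ind: _ => [|b c|p /us pu]; first exact: int_over0.
  exact: int_overD.
exact/int_overMl/int_over_gen.
Qed.

Lemma int_overX n m a : int_over n a -> int_over (n * m) (a ^+ m).
Proof.
move=> ia; elim: m => [|m IHm]; first by rewrite muln0; apply: int_over_const.
by rewrite mulnS exprS; apply: int_overM.
Qed.

(** The element a T^n is a root of the monic polynomial X^m - a^m T^(n m), whose coefficients are
    integral over the Rees algebra; integrality is transitive. *)
Lemma int_over_root n m a :
  (0 < m)%N -> int_over (n * m) (a ^+ m) -> int_over n a.
Proof.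
move=> m_gt0 iam.
apply: (@integral_root_monic _ _ _ _ ('X^m - (a ^+ m *: 'X^(n * m))%:P)).
- by rewrite monicE lead_coefDl ?lead_coefXn // size_opp size_polyC size_polyXn;
     rewrite ltnS (leq_trans (leq_b1 _)).
- by rewrite rootE !hornerE exprZn -exprM subrr.
apply/integral_poly=> i; rewrite coefB coefXn coefC.
apply: integral_sub; first exact: integral_nat.
by case: ifP => // _; apply: integral0.
Qed.

(** In a monic equation of degree m for a T over the Rees algebra, the coefficient of T^m is an
    equation for a whose i-th coefficient lies in the i-th power of the ideal. *)
Lemma int_over_integral a :
  int_over 1 a -> integral_over_ideal (seq_ideal s) a.
Proof.
case=> p mon_p; rewrite expr1.
have [m sz_p] : exists m, size p = m.+1.
  by exists (size p).-1; rewrite prednK // size_poly_gt0 monic_neq0.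
have pm : p`_m = 1 by rewrite -(monicP mon_p) lead_coefE sz_p.
have sz_rp : size (map_poly rees p) = m.+1.
  by rewrite -sz_p size_map_poly_id0 // (monicP mon_p) rmorph1 oner_neq0.
move/rootP; rewrite horner_coef sz_rp => /(congr1 (fun f : {poly R} => f`_m)).
rewrite coef0 coef_sum.
under eq_bigr => i _.
  rewrite coef_map exprZn -scalerAr coefZ coefMXn ltnNge -ltnS ltn_ord /=.
over.
have pm1 : (rees p`_m)`_0 = 1 by rewrite pm rmorph1 coef1.
rewrite big_ord_recr /= subnn pm1 mulr1 => eq0.
have m_gt0 : (0 < m)%N.
  rewrite lt0n; apply/eqP=> m0; move/eqP: eq0; rewrite m0 big_ord0 add0r expr0.
  by rewrite oner_eq0.
exists m, (fun i => (rees p`_(m - i))`_i); split=> // [i _|]; first exact: coef_rees.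
rewrite big_add1 /= big_mkord (reindex_inj rev_ord_inj) /= addrC -[RHS]eq0.
congr (_ + _); apply: eq_bigr => i _.
by rewrite subnSK // subKn 1?ltnW // mulrC.
Qed.
End Rees.

(** * Parametrising the surface [g = 0] *)

Definition vx : {mpoly rat[4]} := 'X_(@Ordinal 4 0 isT).
Definition vy : {mpoly rat[4]} := 'X_(@Ordinal 4 1 isT).
Definition vz : {mpoly rat[4]} := 'X_(@Ordinal 4 2 isT).
Definition vt : {mpoly rat[4]} := 'X_(@Ordinal 4 3 isT).

Lemma mpoly4_ind (P : {mpoly rat[4]} -> Prop) :
  (forall c, P c%:MP) -> (forall p q, P p -> P q -> P (p + q)) ->
  (forall p, P p -> P (vx * p)) -> (forall p, P p -> P (vy * p)) ->
  (forall p, P p -> P (vz * p)) -> (forall p, P p -> P (vt * p)) ->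
  forall p, P p.
Proof.
move=> PC PD Px Py Pz Pt; apply: mpoly_ring_ind => //.
case=> [[|[|[|[|//]]]] lti4] p Pp.
- by rewrite (_ : Ordinal lti4 = @Ordinal 4 0 isT); [apply: Px | apply: val_inj].
- by rewrite (_ : Ordinal lti4 = @Ordinal 4 1 isT); [apply: Py | apply: val_inj].
- by rewrite (_ : Ordinal lti4 = @Ordinal 4 2 isT); [apply: Pz | apply: val_inj].
- by rewrite (_ : Ordinal lti4 = @Ordinal 4 3 isT); [apply: Pt | apply: val_inj].
Qed.

Local Notation poly3 := {poly {poly {poly rat}}}.

Section Eval3.
Variables (S : comNzRingType) (f : {rmorphism rat -> S}) (a b c : S).

Definition eval1 : {poly rat} -> S := horner_eval c \o map_poly f.
HB.instance Definition _ := GRing.RMorphism.on eval1.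

(** The outermost variable stands for x, the middle one for y and the innermost for t (or u), so
    that the coefficient of x^i y^j is a one-variable polynomial. *)
Definition eval3 : poly3 -> S :=
  horner_eval a \o map_poly (horner_eval b \o map_poly eval1).
HB.instance Definition _ := GRing.RMorphism.on eval3.

Lemma eval1C k : eval1 k%:P = f k.
Proof. by rewrite /eval1 /= map_polyC /= /horner_eval hornerC. Qed.

Lemma eval1X : eval1 'X = c.
Proof. by rewrite /eval1 /= map_polyX /= /horner_eval hornerX. Qed.

Lemma eval3C h : eval3 h%:P%:P = eval1 h.
Proof.
by rewrite /eval3 /= map_polyC /= map_polyC /= /horner_eval !hornerC.
Qed.

Lemma eval3X : eval3 'X = a.
Proof. by rewrite /eval3 /= map_polyX /horner_eval hornerX. Qed.

Lemma eval3Y : eval3 'X%:P = b.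
Proof.
by rewrite /eval3 /= map_polyC /= map_polyX /= /horner_eval hornerC hornerX.
Qed.

Lemma eval3E (F : poly3) n :
  (size F <= n)%N -> (forall i, (size (F`_i)%R <= n)%N) ->
  eval3 F = \sum_(i < n) \sum_(j < n) eval1 F`_i`_j * a ^+ i * b ^+ j.
Proof.
move=> szF szFi; rewrite /eval3 /= {1}/horner_eval.
rewrite (@horner_coef_wide _ n); last exact: leq_trans (size_poly _ _) szF.
apply: eq_bigr => i _; rewrite coef_map /= {1}/horner_eval.
rewrite (@horner_coef_wide _ n); last exact: leq_trans (size_poly _ _) (szFi i).
by rewrite mulr_suml; apply: eq_bigr => j _; rewrite coef_map mulrAC.
Qed.
End Eval3.

Lemma poly3_bound (F G : poly3) N :
  exists2 n, (N <= n)%N &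
    [/\ (size F <= n)%N, (forall i, (size (F`_i)%R <= n)%N),
        (size G <= n)%N & (forall i, (size (G`_i)%R <= n)%N)].
Proof.
have inner (H : poly3) : exists m, forall i, (size (H`_i)%R <= m)%N.
  exists (\max_(i < size H) size (H`_i)%R) => i.
  have [lti|gei] := ltnP i (size H); last by rewrite nth_default ?size_poly0.
  exact: (@leq_bigmax _ (fun i : 'I_(size H) => size (H`_i)%R) (Ordinal lti)).
have [k kF] := inner F; have [l lG] := inner G.
exists (N + (size F + size G + (k + l)))%N; first exact: leq_addr.
by split=> [|i||i]; try lia; [have := kF i | have := lG i]; lia.
Qed.

Section Param.
Variables (S : comNzRingType) (f : {rmorphism rat -> S}) (a b u : S).

(* The surface [g = 0] is parametrised by [z = x^2 u], [t = - 3 u^2].         *)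
Definition par : {mpoly rat[4]} -> S :=
  mmap f (fun i => [:: a; b; a ^+ 2 * u; - 3%:R * u ^+ 2]`_i).
HB.instance Definition _ := GRing.RMorphism.on par.

Lemma parC c : par c%:MP = f c.
Proof. exact: mmapC. Qed.
Lemma par_x : par vx = a.
Proof. by rewrite /par mmapX mmap1U. Qed.
Lemma par_y : par vy = b.
Proof. by rewrite /par mmapX mmap1U. Qed.
Lemma par_z : par vz = a ^+ 2 * u.
Proof. by rewrite /par mmapX mmap1U. Qed.
Lemma par_t : par vt = - 3%:R * u ^+ 2.
Proof. by rewrite /par mmapX mmap1U. Qed.

Definition parE := (par_x, par_y, par_z, par_t).

Lemma par_eval1 h : par (eval1 (@mpolyC 4 rat) vt h) = eval1 f (- 3%:R * u ^+ 2) h.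
Proof.
rewrite /eval1 /= /horner_eval -[LHS]horner_map /= par_t -map_poly_comp.
by congr (_.[_]); apply: eq_map_poly => c /=; rewrite parC.
Qed.

Lemma par_eval3 F :
  par (eval3 (@mpolyC 4 rat) vx vy vt F) = eval3 f a b (- 3%:R * u ^+ 2) F.
Proof.
have [n _ [szF szFi _ _]] := poly3_bound F F 0.
rewrite !(eval3E _ _ _ _ szF szFi) rmorph_sum; apply: eq_bigr => i _.
rewrite rmorph_sum; apply: eq_bigr => j _.
by rewrite !rmorphM !rmorphXn /= par_eval1 par_x par_y.
Qed.
End Param.

Definition CP3 : rat -> poly3 := polyC \o (polyC \o polyC).
HB.instance Definition _ := GRing.RMorphism.on CP3.

Definition par3 := par CP3 'X 'X%:P 'X%:P%:P.
HB.instance Definition _ := GRing.RMorphism.on par3.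

(** [par3] is the generic parametrisation, with independent x, y, u; all the others specialise
    it. *)
Lemma par_par3 (S : comNzRingType) (f : {rmorphism rat -> S}) a b u r :
  par f a b u r = eval3 f a b u (par3 r).
Proof.
elim/mpoly4_ind: r => [c|p q IHp IHq|p IHp|p IHp|p IHp|p IHp].
- by rewrite /par3 !parC /CP3 /= eval3C eval1C.
- by rewrite !rmorphD /= IHp IHq.
- by rewrite !rmorphM /= IHp /par3 !parE /= eval3X.
- by rewrite !rmorphM /= IHp /par3 !parE /= eval3Y.
- by rewrite !rmorphM /= IHp /par3 !parE rmorphM rmorphXn /= eval3X eval3C eval1X.
- by rewrite !rmorphM /= IHp /par3 !parE rmorphM rmorphXn rmorphN /= eval3C eval1X
    rmorph_nat.
Qed.

Lemma coef_sum3 (F : nat -> nat -> {poly rat}) n k l :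
  (\sum_(i < n) \sum_(j < n) (F i j)%:P%:P * 'X ^+ i * 'X%:P ^+ j)`_k`_l
    = if (k < n)%N && (l < n)%N then F k l else 0 :> {poly rat}.
Proof.
transitivity (\poly_(i < n) \poly_(j < n) F i j)`_k`_l.
  congr ((_ : poly3)`_k`_l); rewrite poly_def; apply: eq_bigr => i _.
  rewrite poly_def -mul_polyC rmorph_sum mulr_suml; apply: eq_bigr => j _ /=.
  by rewrite -mul_polyC rmorphM rmorphXn /= mulrAC.
by rewrite coef_poly; case: ifP => _ /=; rewrite ?coef0 // coef_poly.
Qed.

Definition w3 : {poly rat} := - 3%:R * 'X ^+ 2.

Lemma coef_par3_eval3 F k l :
  (par3 (eval3 (@mpolyC 4 rat) vx vy vt F))`_k`_l = F`_k`_l \Po w3.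
Proof.
have [n _ [szF szFi _ _]] := poly3_bound F F 0.
rewrite /par3 par_eval3 (eval3E _ _ _ _ szF szFi).
have e h : eval1 CP3 (- 3%:R * 'X%:P%:P ^+ 2) h = (h \Po w3)%:P%:P :> poly3.
  have <- : w3%:P%:P = - 3%:R * 'X%:P%:P ^+ 2 :> poly3.
    by rewrite /w3 !(rmorphM, rmorphN, rmorph_nat, rmorphXn).
  rewrite /eval1 /= /comp_poly /horner_eval -!horner_map /=.
  by congr (_.[_]); rewrite -!map_poly_comp; apply: eq_map_poly.
under eq_bigr => i _ do under eq_bigr => j _ do rewrite e.
rewrite (coef_sum3 (fun i j => F`_i`_j \Po w3)).
case: ltnP => [_|k_n] /=; last first.
  by rewrite [F`_k]nth_default ?(leq_trans szF) // coef0 comp_poly0.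
by case: ltnP => // l_n; rewrite [_`_l]nth_default ?comp_poly0 // (leq_trans (szFi k)).
Qed.

(** * Certificates of membership *)

Definition vg : {mpoly rat[4]} := vx ^+ 4 * vt + 3 * vz ^+ 2.
Definition vq : {mpoly rat[4]} := 3 * vx ^+ 2 + 2 * vz * vt.
Definition vp : {mpoly rat[4]} := 4 * vt ^+ 3 + 27.

Definition Jgens : seq {mpoly rat[4]} :=
  [:: vx ^+ 4 * vt + 3 * vz ^+ 2; vx ^+ 4 * vz; vy ^+ 5;
      3 * vx ^+ 5 + 2 * vx ^+ 3 * vz * vt].

Definition Kgens : seq {mpoly rat[4]} :=
  [:: 3 * vx ^+ 2 * vy * vz + 2 * vy * vz ^+ 2 * vt;
      3 * vx ^+ 3 * vz + 2 * vx * vz ^+ 2 * vt;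
      vx ^+ 4 * vt + 3 * vz ^+ 2;
      vy ^+ 4 * vz;
      vx ^+ 4 * vz;
      vy ^+ 5;
      3 * vx ^+ 2 * vy ^+ 3 + 2 * vy ^+ 3 * vz * vt;
      3 * vx ^+ 3 * vy ^+ 2 + 2 * vx * vy ^+ 2 * vz * vt;
      9 * vx ^+ 4 * vy - 4 * vy * vz ^+ 2 * vt ^+ 2;
      3 * vx ^+ 5 + 2 * vx ^+ 3 * vz * vt;
      vx ^+ 3 * vy * vz * vt;
      vx ^+ 4 * vy ^+ 2;
      4 * vy ^+ 3 * vz * vt ^+ 3 + 27 * vy ^+ 3 * vz;
      vx * vy ^+ 3 * vz * vt ^+ 2;
      2 * vx ^+ 3 * vy ^+ 2 * vt ^+ 2 - 9 * vx * vy ^+ 2 * vz;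
      4 * vx * vy ^+ 4 * vt ^+ 3 + 27 * vx * vy ^+ 4].

Definition JJ : {pred {mpoly rat[4]}} := seq_ideal (R := {mpoly rat[4]}) Jgens.
Definition KK : {pred {mpoly rat[4]}} := seq_ideal (R := {mpoly rat[4]}) Kgens.

Lemma idealJ : ideal_pred JJ. Proof. exact: ideal_gen_ideal. Qed.
Lemma idealK : ideal_pred KK. Proof. exact: ideal_gen_ideal. Qed.

(** [c] lists the cofactors of the generators; since [zip] truncates, trailing zeros may be left
    out. *)
Lemma mem_seq_ideal (R : comNzRingType) (s c : seq R) r :
  r = \sum_(p <- zip c s) p.1 * p.2 -> r \in seq_ideal s.
Proof.
move=> ->; apply/ideal_genP; exists (zip c s); split=> // p.
elim: s c => [|a s IHs] [|b c] //=; rewrite !inE => /predU1P[->|/IHs->].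
  by rewrite eqxx.
by rewrite orbT.
Qed.

Lemma ideal_natl (n : nat) (I : {pred {mpoly rat[n]}}) k r :
  ideal_pred I -> k.+1%:R * r \in I -> r \in I.
Proof.
case=> _ _ IM rI.
suff <- : (k.+1%:R^-1)%:MP * (k.+1%:R * r) = r by apply: IM.
rewrite mulrA -(rmorph_nat (@mpolyC n rat)) -rmorphM mulVf ?rmorph1 ?mul1r //.
by rewrite pnatr_eq0.
Qed.

(* The cofactors [c] certify n + 1 times the element, which clears rational denominators. *)
Tactic Notation "cert" uconstr(n) uconstr(c) :=
  refine (@ideal_natl _ _ n _ _ _); [exact: ideal_gen_ideal |];
  refine (@mem_seq_ideal {mpoly rat[4]} _ c _ _); rewrite /= !big_cons big_nil /=;
  rewrite ?/vg ?/vq ?/vp; ring.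

Lemma J_x6 : vx ^+ 6 \in JJ.
Proof. cert 2 [:: 0; - 2 * vt; 0; vx]. Qed.
Lemma J_z3 : vz ^+ 3 \in JJ.
Proof. cert 2 [:: vz; - vt; 0; 0]. Qed.
Lemma J_x4z : vx ^+ 4 * vz \in JJ.
Proof. cert 0 [:: 0; 1 : {mpoly rat[4]}; 0; 0]. Qed.
Lemma J_y5 : vy ^+ 5 \in JJ.
Proof. cert 0 [:: 0; 0; 1 : {mpoly rat[4]}; 0]. Qed.
Lemma J_g : vg \in JJ.
Proof. cert 0 [:: 1 : {mpoly rat[4]}; 0; 0; 0]. Qed.
Lemma J_x3q : vx ^+ 3 * vq \in JJ.
Proof. cert 0 [:: 0; 0; 0; 1]. Qed.

(** Give x and y weight 1 and z weight 2, as z = x^2 u suggests. With [K_topz], this puts in K all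
    weight 6 monomials in x, y, z of degree at most one in z. *)
Lemma K_top j : (j < 7)%N -> vx ^+ (6 - j) * vy ^+ j \in KK.
Proof.
case: j => [|[|[|[|[|[|[|//]]]]]]] _ /=.
- cert 2 [:: 0; 0; 0; 0; - 2 * vt; 0; 0; 0; 0; vx].
- cert 2 [:: 0; 0; 0; 0; 0; 0; 0; 0; 0; vy; - 2].
- cert 0 [:: 0; 0; 0; 0; 0; 0; 0; 0; 0; 0; 0; 1].
- cert 80 [:: 0; 0; 0; 0; 0; 0; 27 * vx; 0; 0; 0; 0; 0; - 2 * vt * vx; 8 * vt ^+ 2].
- cert 2 [:: 0; 0; 0; - 2 * vt; 0; 0; vy].
- cert 0 [:: 0; 0; 0; 0; 0; vx].
- cert 0 [:: 0; 0; 0; 0; 0; vy].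
Qed.

Lemma K_topz j : (j < 5)%N -> vx ^+ (4 - j) * vy ^+ j * vz \in KK.
Proof.
case: j => [|[|[|[|[|//]]]]] _ /=.
- cert 0 [:: 0; 0; 0; 0; 1].
- cert 26 [:: 9 * vx; 0; - 6 * vx * vy * vt; 0; 0; 0; 0; 0; 0; 2 * vt ^+ 2 * vy;
    - 4 * vt ^+ 2].
- cert 8 [:: 0; 0; 0; 0; 0; 0; 0; 0; 0; 0; 0; 2 * vt ^+ 2; 0; 0; - vx].
- cert 26 [:: 0; 0; 0; 0; 0; 0; 0; 0; 0; 0; 0; 0; vx; - 4 * vt].
- cert 0 [:: 0; 0; 0; 1].
Qed.

(** In weight 5 this expresses x^(5 - j) y^j through x^(3 - j) y^j z, leaving a cyclic Q[t]-module
    for each j; [K_prow] then says that p kills it. *)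
Lemma K_qrow j : (j < 4)%N -> vx ^+ (3 - j) * vy ^+ j * vq \in KK.
Proof.
case: j => [|[|[|[|//]]]] _ /=.
- cert 0 [:: 0; 0; 0; 0; 0; 0; 0; 0; 0; 1].
- cert 2 [:: 2 * vt; 0; 0; 0; 0; 0; 0; 0; 1].
- cert 0 [:: 0; 0; 0; 0; 0; 0; 0; 1].
- cert 0 [:: 0; 0; 0; 0; 0; 0; 1].
Qed.

Lemma K_prow j : (j < 4)%N -> vp * (vx ^+ (3 - j) * vy ^+ j * vz) \in KK.
Proof.
case: j => [|[|[|[|//]]]] _ /=.
- cert 0 [:: 0; 9; - 6 * vx * vt; 0; 0; 0; 0; 0; 0; 2 * vt ^+ 2].
- cert 2 [:: 27 + 4 * vt ^+ 3; 0; - 18 * vy * vt; 0; 0; 0; 0; 0; 2 * vt ^+ 2].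
- cert 0 [:: 0; 0; 0; 0; 0; 0; 0; 2 * vt ^+ 2; 0; 0; 0; 0; 0; 0; - 3].
- cert 0 [:: 0; 0; 0; 0; 0; 0; 0; 0; 0; 0; 0; 0; 1].
Qed.

Lemma K_pxy4 : vp * (vx * vy ^+ 4) \in KK.
Proof. cert 0 [:: 0; 0; 0; 0; 0; 0; 0; 0; 0; 0; 0; 0; 0; 0; 0; 1]. Qed.

(** * Elements of order five *)

Local Notation ev3 := (eval3 (@mpolyC 4 rat) vx vy vt).
Local Notation ev1 := (eval1 (@mpolyC 4 rat) vt).

Lemma decompose r : exists A B c, r = ev3 A + vz * ev3 B + c * vg.
Proof.
elim/mpoly4_ind: r => [k|_ _ [A [B [c ->]]] [A' [B' [c' ->]]]|_ [A [B [c ->]]]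
    |_ [A [B [c ->]]]|_ [A [B [c ->]]]|_ [A [B [c ->]]]].
- by exists k%:P%:P%:P, 0, 0; rewrite rmorph0 eval3C eval1C; ring.
- by exists (A + A'), (B + B'), (c + c'); rewrite !rmorphD /=; ring.
- by exists ('X * A), ('X * B), (vx * c); rewrite !rmorphM /= eval3X; ring.
- by exists ('X%:P * A), ('X%:P * B), (vy * c); rewrite !rmorphM /= eval3Y; ring.
(* The square of z is replaced by (g - x^4 t) / 3. *)
- exists (- ((3^-1 : rat)%:P * 'X)%:P%:P * 'X ^+ 4 * B), A, (vz * c + (3^-1)%:MP * ev3 B).
  rewrite !(rmorphM ev3) rmorphN /= eval3C rmorphM /= eval1C eval1X eval3X /vg.
  have e3 : (3^-1)%:MP * 3 = 1 :> {mpoly rat[4]}.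
    by rewrite -(rmorph_nat (@mpolyC 4 rat)) -rmorphM mulVf ?rmorph1.
  transitivity (vz * (ev3 A + c * (vx ^+ 4 * vt + 3 * vz ^+ 2)) +
     ((3^-1)%:MP * 3) * (vz ^+ 2 * ev3 B)); last ring.
  by rewrite e3 /vg; ring.
- by exists ('X%:P%:P * A), ('X%:P%:P * B), (vt * c);
    rewrite !rmorphM /= eval3C eval1X; ring.
Qed.

(** The shift by x^2 comes from z = x^2 u; the remaining factor u stays outside. *)
Definition shift2 (B : poly3) i j : {poly rat} :=
  (if i is i'.+2 then B`_i'`_j else 0).

Lemma coef_par3_decompose A B c i j :
  (par3 (ev3 A + vz * ev3 B + c * vg))`_i`_j
    = A`_i`_j \Po w3 + 'X * (shift2 B i j \Po w3).
Proof.
have g0 : par3 vg = 0.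
  by rewrite /par3 /vg !(rmorphD, rmorphM, rmorphXn, rmorph_nat) /= !parE; ring.
rewrite !rmorphD !rmorphM /= g0 mulr0 addr0 !coefD coef_par3_eval3; congr (_ + _).
have -> : par3 vz * par3 (ev3 B) = 'X%:P%:P * (par3 (ev3 B) * 'X^2).
  by rewrite /par3 par_z; ring.
rewrite !coefCM coefMXn; case: i => [|[|i]] /=; rewrite ?coef0 ?comp_poly0 ?mulr0 //.
by rewrite subn2 /= coef_par3_eval3.
Qed.

(* Since [w3 = - 3 u^2] is even in [u], the summands below are its even and odd part. *)
Lemma comp_w3_eq0 (h k : {poly rat}) :
  h \Po w3 + 'X * (k \Po w3) = 0 -> h = 0 /\ k = 0.
Proof.
move=> eq0; have w3N : w3 \Po (- 'X) = w3.
  by rewrite /w3 rmorphM rmorphXn rmorphN rmorph_nat /= comp_polyX sqrrN.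
have sz_w3 : (1 < size w3)%N.
  rewrite /w3 -(rmorph_nat (@polyC rat)) -rmorphN mul_polyC size_scale ?size_polyXn //.
(* Substituting -u only changes the sign of the second summand. *)
have /eqP := congr1 (fun f => f \Po (- 'X)) eq0.
rewrite comp_poly0 rmorphD rmorphM /= -!comp_polyA w3N comp_polyX mulNr.
rewrite subr_eq0 => /eqP eqhk; move: eq0; rewrite eqhk -mulr2n -mulr_natl.
move/eqP; rewrite mulf_eq0 -(rmorph_nat (@polyC rat)) polyC_eq0 /= mulf_eq0 polyX_eq0 /=.
rewrite comp_poly_eq0 // => /eqP k0; move/eqP: eqhk.
by rewrite k0 comp_poly0 mulr0 comp_poly_eq0 // => /eqP.
Qed.

(** Used to discard monomials: in column j < N only the exponent [e j] of x survives modulo [I], and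
    the columns from N on vanish. *)
Lemma eval3_rows (I : {pred {mpoly rat[4]}}) (m : {mpoly rat[4]}) (F : poly3) N
    (e : nat -> nat) :
  ideal_pred I ->
  (forall i j, ~~ ((j < N)%N && (i == e j)) ->
     ev1 F`_i`_j * vx ^+ i * vy ^+ j * m \in I) ->
  ev3 F * m - \sum_(0 <= j < N) ev1 F`_(e j)`_j * vx ^+ e j * vy ^+ j * m \in I.
Proof.
move=> iI mI; have iD : forall a b, a \in I -> b \in I -> a + b \in I by case: iI.
have [n leNn [szF szFi _ _]] := poly3_bound F F (N + \max_(j < N) e j).+1.
rewrite (eval3E _ _ _ _ szF szFi) exchange_big mulr_suml big_mkord /=.
rewrite (big_ord_widen n (fun j => ev1 F`_(e j)`_j * vx ^+ e j * vy ^+ j * m));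
  last by lia.
rewrite [X in _ - X]big_mkcond -sumrB; apply: ideal_sum => // j _.
case: ifPn => [ltj|gej]; rewrite mulr_suml; last first.
  by rewrite subr0; apply: ideal_sum => // i _; apply: mI; rewrite (negPf gej).
have ltej : (e j < n)%N.
  apply: leq_trans leNn; rewrite ltnS (leq_trans _ (leq_addl _ _)) //.
  exact: (@leq_bigmax _ (fun j : 'I_N => e j) (Ordinal ltj)).
rewrite (bigD1 (Ordinal ltej)) //= addrAC subrr add0r; apply: ideal_sum => // i.
by rewrite -val_eqE /= => ne; apply: mI; rewrite ltj.
Qed.

Lemma mem_eq (T : Type) (I : {pred T}) (a b : T) : a \in I -> b = a -> b \in I.
Proof. by move=> aI ->. Qed.

(** The monomial is divisible by one of [K_top], chosen with as many factors y as possible, namely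
    [l]. *)
Lemma K_mon i j : (5 < i + j)%N -> vx ^+ i * vy ^+ j \in KK.
Proof.
move=> lt5; pose l := minn j 6; have [_ _ IM] := idealK.
have -> : vx ^+ i * vy ^+ j =
    vx ^+ (i - (6 - l)) * vy ^+ (j - l) * (vx ^+ (6 - l) * vy ^+ l).
  by rewrite mulrACA -!exprD !subnK //; rewrite /l; lia.
by apply: IM; apply: K_top; rewrite /l; lia.
Qed.

Lemma K_monz i j : (3 < i + j)%N -> vx ^+ i * vy ^+ j * vz \in KK.
Proof.
move=> lt3; pose l := minn j 4; have [_ _ IM] := idealK.
have -> : vx ^+ i * vy ^+ j * vz =
    vx ^+ (i - (4 - l)) * vy ^+ (j - l) * (vx ^+ (4 - l) * vy ^+ l * vz).
  rewrite mulrA; congr (_ * _).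
  by rewrite mulrACA -!exprD !subnK //; rewrite /l; lia.
by apply: IM; apply: K_topz; rewrite /l; lia.
Qed.

Lemma K_y5 : vy ^+ 5 \in KK. Proof. cert 0 [:: 0; 0; 0; 0; 0; 1]. Qed.
Lemma K_g : vg \in KK. Proof. cert 0 [:: 0; 0; 1]. Qed.

(* Order at least 5 along [x = y = 0] on the surface [g = 0]. *)
Definition order5 (r : {mpoly rat[4]}) : Prop :=
  forall i j, (i + j < 5)%N -> (par3 r)`_i`_j = 0.

(** The weight 5 monomials of degree at most one in z, with coefficients in Q[t]; y^5 is absent
    because it lies in K. *)
Definition rows (a b : nat -> {poly rat}) : {mpoly rat[4]} :=
  \sum_(0 <= j < 5) ev1 (a j) * vx ^+ (5 - j) * vy ^+ j
  + \sum_(0 <= j < 4) ev1 (b j) * vx ^+ (3 - j) * vy ^+ j * vz.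

(** Order 5 kills all terms of weight below 5 in the normal form A + z B, by parity in u; K contains
    those of weight above 5. *)
Lemma order5_rows r : order5 r -> exists a b, r - rows a b \in KK.
Proof.
move=> r5; have [A [B [c def_r]]] := decompose r; have [K0 KD KM] := idealK.
have AB0 i j : (i + j < 5)%N -> A`_i`_j = 0 /\ shift2 B i j = 0.
  by move=> ij; apply: comp_w3_eq0; rewrite -(coef_par3_decompose A B c) -def_r r5.
have iA : ev3 A * 1
    - \sum_(0 <= j < 5) ev1 A`_(5 - j)`_j * vx ^+ (5 - j) * vy ^+ j * 1 \in KK.
  apply: (@eval3_rows _ _ _ _ (fun j => 5 - j)%N idealK) => i j ij; rewrite mulr1.
  have [lt5|] := ltnP (i + j) 5.
    by have [-> _] := AB0 _ _ lt5; rewrite rmorph0 !mul0r.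
  rewrite leq_eqVlt => /orP[/eqP eq5|]; rewrite -mulrA; last by move/K_mon; apply: (KM).
  (* The only monomial of degree 5 outside the rows is y^5. *)
  apply: (KM); have -> : j = 5 by lia.
  by apply: (KM); apply: K_y5.
have iB : ev3 B * vz
    - \sum_(0 <= j < 4) ev1 B`_(3 - j)`_j * vx ^+ (3 - j) * vy ^+ j * vz \in KK.
  apply: (@eval3_rows _ _ _ _ (fun j => 3 - j)%N idealK) => i j ij.
  have [lt3|] := ltnP (i + j) 3.
    have lt5 : (i.+2 + j < 5)%N by lia.
    by have [_ /= ->] := AB0 _ _ lt5; rewrite rmorph0 !mul0r.
  rewrite -!mulrA [X in _ * X]mulrA leq_eqVlt => /orP[/eqP eq3|/K_monz].
    by exfalso; lia.
  exact: KM.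
move: iA; rewrite mulr1; under eq_bigr => j _ do rewrite mulr1.
move=> iA; exists (fun j => A`_(5 - j)`_j), (fun j => B`_(3 - j)`_j).
apply: mem_eq (KD _ _ (KD _ _ iA iB) (KM c _ K_g)) _.
by rewrite def_r /rows; ring.
Qed.

Lemma order5_pK r : order5 r -> vp * r \in KK.
Proof.
move=> /order5_rows[a [b rK]]; have [K0 KD KM] := idealK.
rewrite -(subrK (rows a b) r) mulrDr; apply: (KD); first exact: KM.
rewrite mulrDr !mulr_sumr; apply: (KD); rewrite big_nat_cond; apply: ideal_sum;
  rewrite ?idealK // => j /[!andbT] /andP[_ ltj].
  rewrite -mulrA mulrCA; apply: (KM).
  have [ltj4|gej4] := ltnP j 4; last first.
    have -> : j = 4 by lia.
    exact: K_pxy4.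
  (* Three times x^(5 - j) y^j is x^(3 - j) y^j q - 2 t x^(3 - j) y^j z, and p sends both terms into
     K. *)
  apply: (ideal_natl (k := 2) idealK).
  apply: mem_eq (KD _ _ (KM vp _ (K_qrow ltj4)) (KM (- 2 * vt) _ (K_prow ltj4))) _.
  have -> : (5 - j = 3 - j + 2)%N by lia.
  by rewrite exprD /vq; ring.
by rewrite -!mulrA mulrCA; apply: (KM); rewrite mulrA -mulrA mulrA; apply: K_prow.
Qed.

(** * Elements of order thirty *)

Definition pQ : {poly rat} := 4 * 'X ^+ 3 + 27.

Lemma ev1_pQ : ev1 pQ = vp.
Proof. by rewrite /pQ rmorphD rmorphM rmorphXn !rmorph_nat /= eval1X. Qed.

Lemma size_pQ : size pQ = 4.
Proof.
have -> : pQ = 4%:R *: 'X^3 + 27%:R%:P.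
  by rewrite /pQ -mul_polyC !rmorph_nat.
by rewrite size_polyDl size_scale ?size_polyXn // size_polyC.
Qed.

Lemma pQ_neq0 : pQ != 0.
Proof. by rewrite -size_poly_eq0 size_pQ. Qed.

(* A root [n / d] would give [4 |n|^3 = 27 |d|^3], where the exponents of 2 on the *)
(* two sides differ modulo 3.                                                    *)
Lemma pQ_noroot (r : rat) : ~~ root pQ r.
Proof.
apply/negP => /rootP; rewrite -/(horner_eval r pQ) /pQ rmorphD rmorphM rmorphXn.
rewrite !rmorph_nat /= {1}/horner_eval hornerX => eq0.
have r0 : r != 0.
  by apply/eqP => r0; move/eqP: eq0; rewrite r0 expr0n mulr0 add0r pnatr_eq0.
have d0 : (denq r)%:~R != 0 :> rat by rewrite intr_eq0 denq_neq0.
have : 4 * (numq r) ^+ 3 = - 27 * (denq r) ^+ 3.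
  apply: (@intr_inj rat); apply/eqP; rewrite -subr_eq0; apply/eqP.
  have -> : ((4 * numq r ^+ 3)%:~R - (- 27 * denq r ^+ 3)%:~R : rat)
     = (4 * r ^+ 3 + 27) * (denq r)%:~R ^+ 3.
    have -> : 4 * r ^+ 3 + 27 = 4 * ((numq r)%:~R / (denq r)%:~R) ^+ 3 + 27.
      by rewrite divq_num_den.
    by field.
  by rewrite eq0 mul0r.
move/(congr1 absz); rewrite (abszM 4) (abszM (- 27)) !abszX /= => /(congr1 (logn 2)).
rewrite !lognM ?expn_gt0 ?absz_gt0 ?muln_gt0 ?absz_gt0 ?denq_neq0 ?numq_eq0 ?r0 //.
by rewrite (_ : logn 2 27 = 0) // (_ : logn 2 4 = 2) //; lia.
Qed.

Lemma pQ_irr : irreducible_poly pQ.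
Proof. by apply: cubic_irreducible; [rewrite size_pQ | apply: pQ_noroot]. Qed.

Lemma coprime_pQ h : ~~ (pQ %| h) -> coprimep pQ h.
Proof.
move=> ndvd; rewrite coprimep_def; apply/negPn/negP => sz1.
have /pQ_irr -/(_ (dvdp_gcdl _ _)) eqp : size (gcdp pQ h) != 1 by [].
by move: ndvd; rewrite -(eqp_dvdl _ eqp) dvdp_gcdr.
Qed.

(** On the surface q = 3 x^2 (1 - 2 u^3), which vanishes at u = [c0]; the corresponding t is [t0], a
    root of p because (2 c0^3)^2 = 1. *)
Definition c0 : algC := 3.-root 2^-1.
Definition t0 : algC := - 3 * c0 ^+ 2.

Lemma c0E : 2 * c0 ^+ 3 = 1.
Proof. by rewrite rootCK // divff ?pnatr_eq0. Qed.

Lemma root_pQ : (map_poly ratr pQ).[t0] = 0.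
Proof.
rewrite /pQ rmorphD rmorphM rmorphXn !rmorph_nat /= map_polyX.
rewrite -/(horner_eval t0 _) rmorphD rmorphM rmorphXn !rmorph_nat /= {1}/horner_eval
  hornerX /t0.
transitivity (27 * (1 - (2 * c0 ^+ 3) ^+ 2)); first ring.
by rewrite c0E; ring.
Qed.

(** Otherwise irreducibility gives a Bezout identity, which at [t0] reads 0 = 1. *)
Lemma root_t0 (h : {poly rat}) : (map_poly ratr h).[t0] = 0 -> pQ %| h.
Proof.
move=> h0; apply/negPn/negP => /coprime_pQ co.
have /Bezout_eq1_coprimepP[[u v] /= /(congr1 (fun q => (map_poly ratr q).[t0]))] := co.
rewrite rmorphD !rmorphM rmorph1 !hornerE root_pQ h0 !mulr0 addr0 => /eqP.
by rewrite eq_sym oner_eq0.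
Qed.

Definition CPA : rat -> {poly algC} := polyC \o ratr.
HB.instance Definition _ := GRing.RMorphism.on CPA.

(** The weights give x^4 z and y^5 order 30, and x^3 q as well since 1 - 2 u^3 gains a factor s^5.
    The weight 5 monomials x^(5 - j) y^j, j < 5, get the distinct orders 25 + j, all below 30. *)
Definition phi30 := par CPA ('X ^+ 5) ('X ^+ 6) (c0%:P + 'X ^+ 5).
HB.instance Definition _ := GRing.RMorphism.on phi30.

Lemma eval1_mod5 (a : algC) d h :
  exists k, eval1 CPA (a%:P + 'X ^+ 5 * d) h = (map_poly ratr h).[a]%:P + 'X ^+ 5 * k.
Proof.
elim/poly_ind: h => [|h c [k IHh]].
  by exists 0; rewrite !rmorph0 horner0; ring.
exists (k * (a%:P + 'X ^+ 5 * d) + (map_poly ratr h).[a]%:P * d).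
rewrite !rmorphD !rmorphM /= eval1X eval1C IHh map_polyX map_polyC /=.
by rewrite hornerD hornerM hornerX hornerC rmorphD rmorphM /= /CPA /=; ring.
Qed.

Lemma phi30_ev1 h : exists k, phi30 (ev1 h) = (map_poly ratr h).[t0]%:P + 'X ^+ 5 * k.
Proof.
rewrite /phi30 par_eval1.
have -> : - 3%:R * (c0%:P + 'X ^+ 5) ^+ 2
    = t0%:P + 'X ^+ 5 * (- 3 * (2 * c0%:P + 'X ^+ 5)) :> {poly algC}.
  rewrite /t0 rmorphM rmorphN rmorphXn rmorph_nat /=; ring.
exact: eval1_mod5.
Qed.

(** Apart from its term of degree 25 + j, the j-th summand only has terms of degree at least 30 + j,
    so degrees 25 to 29 do not mix. *)
Lemma coef_sum_mod5 (S : comNzRingType) (al : nat -> S) (k : nat -> {poly S}) N l :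
  (l < 5)%N ->
  (\sum_(0 <= j < N) ((al j)%:P + 'X ^+ 5 * k j) * 'X ^+ (25 + j))`_(25 + l)
    = if (l < N)%N then al l else 0.
Proof.
move=> lt5; rewrite coef_sum.
transitivity (\sum_(0 <= j < N | j == l) al j).
  rewrite [RHS]big_mkcond; apply: eq_bigr => j _.
  rewrite coefMXn ltn_add2l subnDl; case: ltngtP => // [ltj|->]; last first.
    by rewrite subnn coefD coefC coefXnM addr0.
  rewrite coefD coefC coefXnM ifN -?lt0n ?subn_gt0 // add0r ifT //.
  by apply: leq_ltn_trans lt5; apply: leq_subr.
by rewrite big_nat1_eq.
Qed.

Lemma phi30_monomial h i j :
  phi30 (ev1 h * vx ^+ i * vy ^+ j) = phi30 (ev1 h) * 'X ^+ (5 * i + 6 * j).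
Proof.
rewrite !(rmorphM phi30) !(rmorphXn phi30) /=.
have -> : phi30 vx = 'X ^+ 5 by rewrite /phi30 par_x.
have -> : phi30 vy = 'X ^+ 6 by rewrite /phi30 par_y.
by rewrite -!exprM -mulrA -exprD.
Qed.

Lemma phi30_z : phi30 vz = 'X ^+ 10 * (c0%:P + 'X ^+ 5).
Proof. by rewrite /phi30 par_z -exprM. Qed.

Lemma phi30_rows a b :
  phi30 (rows a b)
  = \sum_(0 <= j < 5) phi30 (ev1 (a j)) * 'X ^+ (25 + j)
    + \sum_(0 <= j < 4) phi30 (ev1 (b j)) * 'X ^+ (25 + j) * (c0%:P + 'X ^+ 5).
Proof.
rewrite /rows rmorphD; congr (_ + _); rewrite rmorph_sum /=;
  apply: eq_big_nat => j /andP[_ ltj].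
  rewrite phi30_monomial; congr (_ * 'X ^+ _); lia.
rewrite rmorphM /= phi30_monomial phi30_z mulrA -[_ * 'X ^+ 10]mulrA -exprD.
by congr (_ * 'X ^+ _ * _); lia.
Qed.

Lemma ord30_rows a b : ord_ge 30 (phi30 (rows a b)) ->
  (forall j, (j < 4)%N ->
     (map_poly ratr (a j)).[t0] + c0 * (map_poly ratr (b j)).[t0] = 0)
  /\ (map_poly ratr (a 4)).[t0] = 0.
Proof.
have [ka def_a] := boolp.choice (fun j => phi30_ev1 (a j)).
have [kb def_b] := boolp.choice (fun j => phi30_ev1 (b j)).
pose al j := (map_poly ratr (a j)).[t0]; pose be j := (map_poly ratr (b j)).[t0].
(* The remainder of (be + s^5 kb) (c0 + s^5) after its constant c0 be, divided by s^5. *)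
pose kc j := (be j)%:P + kb j * (c0%:P + 'X ^+ 5).
rewrite phi30_rows (eq_bigr (fun j => ((al j)%:P + 'X ^+ 5 * ka j) * 'X ^+ (25 + j)));
  last by move=> j _; rewrite def_a.
rewrite [X in _ + X](eq_bigr (fun j => ((c0 * be j)%:P + 'X ^+ 5 * kc j) * 'X ^+ (25
  + j)));
  last by move=> j _; rewrite def_b /kc rmorphM -/(be j) /=; ring.
move=> /ord_geP H; split=> [j ltj|].
  have ltj5 : (j < 5)%N by apply: ltnW.
  have := H (25 + j)%N; rewrite coefD !coef_sum_mod5 // ltj ltj5.
  by apply; lia.
by have := H (25 + 4)%N isT; rewrite coefD !coef_sum_mod5 //= addr0.
Qed.

(** Three times the row equals a x^(3 - j) y^j q + (3 b - 2 t a) x^(3 - j) y^j z, and the hypothesis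
    says that p divides 3 b - 2 t a: its value at [t0] is 6 c0^2 (a + c0 b), because 2 c0^3 = 1. *)
Lemma row_in_K a b j : (j < 4)%N ->
  (map_poly ratr a).[t0] + c0 * (map_poly ratr b).[t0] = 0 ->
  ev1 a * vx ^+ (5 - j) * vy ^+ j + ev1 b * vx ^+ (3 - j) * vy ^+ j * vz \in KK.
Proof.
move=> ltj eq0; have [_ KD KM] := idealK.
have /dvdpP[h def_h] : pQ %| 3 * b - 2 * 'X * a.
  apply: root_t0; rewrite -/(horner_eval t0 _).
  rewrite rmorphB !(rmorphM (map_poly ratr)) !rmorph_nat /= map_polyX.
  rewrite rmorphB !(rmorphM (horner_eval t0)) !rmorph_nat /=.
  rewrite /horner_eval hornerX {2}/t0.
  transitivity (6 * c0 ^+ 2 * ((map_poly ratr a).[t0] + c0 * (map_poly ratr b).[t0])).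
    transitivity (3 * (2 * c0 ^+ 3) * (map_poly ratr b).[t0] + 6 * c0 ^+ 2 *
      (map_poly ratr a).[t0]).
      by rewrite c0E; ring.
    by ring.
  by rewrite eq0 mulr0.
apply: (ideal_natl (k := 2) idealK).
apply: mem_eq (KD _ _ (KM (ev1 a) _ (K_qrow ltj)) (KM (ev1 h) _ (K_prow ltj))) _.
have := congr1 (fun f => ev1 f) def_h.
rewrite rmorphB !rmorphM !rmorph_nat /= eval1X ev1_pQ => eqh.
rewrite (_ : 5 - j = 3 - j + 2)%N ?exprD; last by lia.
rewrite [ev1 h * _]mulrA -eqh /vq; ring.
Qed.

(** The difference between r and its rows lies in K, so the bound on K transfers order 30 to the
    rows. That bound will come from the integrality of K over J. *)
Lemma K_of_orders r : order5 r -> ord_ge 30 (phi30 r) ->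
  (forall k, k \in KK -> ord_ge 30 (phi30 k)) -> r \in KK.
Proof.
move=> /order5_rows[a [b rK]] r30 K30; have [K0 KD KM] := idealK.
rewrite -(subrK (rows a b) r); apply: (KD) => //.
have := ord_geD (r30) (K30 _ (idealN idealK rK)).
rewrite -rmorphD opprB addrC subrK => /ord30_rows[ab0 a4].
have ltr j : (j < 4)%N -> ev1 (a j) * vx ^+ (5 - j) * vy ^+ j
    + ev1 (b j) * vx ^+ (3 - j) * vy ^+ j * vz \in KK.
  by move=> ltj; apply: row_in_K => //; apply: ab0.
rewrite /rows big_nat_recr //= addrAC -big_split /=; apply: (KD).
  rewrite big_nat_cond; apply: ideal_sum => [|j /[!andbT] /andP[_ /ltr]//].
  exact: idealK.
have /dvdpP[h ->] := root_t0 a4.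
rewrite rmorphM /= ev1_pQ -!mulrA; apply: (KM); exact: K_pxy4.
Qed.

(** * The integral closure *)

Local Notation intJ := (@int_over {mpoly rat[4]} Jgens).

Lemma intJ_eq n a b : intJ n a -> b = a -> intJ n b.
Proof. by move=> ia ->. Qed.

Lemma intJ_natl n k a : intJ n (k.+1%:R * a) -> intJ n a.
Proof.
move/(int_overMl (k.+1%:R^-1)%:MP)/intJ_eq; apply.
rewrite mulrA -(rmorph_nat (@mpolyC 4 rat)) -rmorphM mulVf ?rmorph1 ?mul1r //.
by rewrite pnatr_eq0.
Qed.

Lemma intJ_root5 a b : intJ 5 b -> a ^+ 5 = b -> intJ 1 a.
Proof. by move=> ib eqb; apply: (@int_over_root _ _ 1 5); rewrite ?eqb. Qed.

Lemma intJ_root2 k a b : intJ 2 b -> k.+1%:R * a ^+ 2 = b -> intJ 1 a.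
Proof.
by move=> ib eqb; apply: (@int_over_root _ _ 1 2) => //; apply: (@intJ_natl _ k);
  rewrite eqb.
Qed.

Lemma intJ_lin n a b c d : intJ n a -> intJ n b -> intJ n (c * a + d * b).
Proof. by move=> ia ib; apply: int_overD; apply: int_overMl. Qed.

Lemma intJ_X m a : intJ 1 a -> intJ m (a ^+ m).
Proof. by move=> ia; have := int_overX m ia; rewrite mul1n. Qed.

Lemma intJ_x6 : intJ 1 (vx ^+ 6). Proof. exact/int_over_seq/J_x6. Qed.
Lemma intJ_z3 : intJ 1 (vz ^+ 3). Proof. exact/int_over_seq/J_z3. Qed.
Lemma intJ_x4z : intJ 1 (vx ^+ 4 * vz). Proof. exact/int_over_seq/J_x4z. Qed.
Lemma intJ_y5 : intJ 1 (vy ^+ 5). Proof. exact/int_over_seq/J_y5. Qed.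
Lemma intJ_g : intJ 1 vg. Proof. exact/int_over_seq/J_g. Qed.
Lemma intJ_x3q : intJ 1 (vx ^+ 3 * vq). Proof. exact/int_over_seq/J_x3q. Qed.

(** On the surface this is 9 x^2 u (2 u^3 - 1), which vanishes together with q; moreover 2 t^2 q - 3
    r = p z. *)
Definition vr : {mpoly rat[4]} := 2 * vx ^+ 2 * vt ^+ 2 - 9 * vz.

Lemma intJ_x2q2 : intJ 1 (vx ^+ 2 * vq ^+ 2).
Proof.
apply: (@intJ_natl _ 2).
apply: intJ_eq (int_overD (intJ_lin (27 - 4 * vt ^+ 3) (36 * vt) intJ_x6 intJ_x4z)
  (int_overMl (4 * vt ^+ 2 * vx ^+ 2) intJ_g)) _.
rewrite /vq /vg; ring.
Qed.

(** Substituting 3 z^2 = g - x^4 t gives 3 (x z q)^2 = g (x q)^2 - t (x^3 q)^2, of degree 2;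
    [intJ_yzq] uses the same device. *)
Lemma intJ_xzq : intJ 1 (vx * vz * vq).
Proof.
apply: (intJ_root2 (k := 2) (intJ_lin 1 (- vt) (int_overM intJ_g intJ_x2q2) (intJ_X 2
  intJ_x3q))).
rewrite /vg; ring.
Qed.

Lemma intJ_xq2 : intJ 1 (vx * vq ^+ 2).
Proof. by apply: intJ_eq (intJ_lin 3 (2 * vt) intJ_x3q intJ_xzq) _; rewrite /vq;
  ring. Qed.

Lemma intJ_z2 n a : intJ n (vg * a) -> intJ n (vx ^+ 4 * a) -> intJ n (vz ^+ 2 * a).
Proof.
move=> ga xa; apply: (@intJ_natl _ 2).
by apply: intJ_eq (intJ_lin 1 (- vt) ga xa) _; rewrite /vg; ring.
Qed.

Lemma intJ_q3 : intJ 1 (vq ^+ 3).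
Proof.
have i1 : intJ 1 (vx ^+ 4 * vq).
  by apply: intJ_eq (int_overMl vx intJ_x3q) _; ring.
have i2 : intJ 1 (vz ^+ 2 * vq).
  by apply: intJ_z2 => //; rewrite mulrC; apply: int_overMl intJ_g.
apply: intJ_eq (int_overD (intJ_lin 9 (12 * vt * vx) i1 intJ_xzq)
  (int_overMl (4 * vt ^+ 2) i2)) _.
rewrite /vq; ring.
Qed.

(** Degree 2 is what makes (y^3 q)^5 = (y^5)^3 q^5 of degree 5. *)
Lemma intJ_q5 : intJ 2 (vq ^+ 5).
Proof.
have i1 : intJ 2 (vx ^+ 4 * vq ^+ 3).
  by apply: intJ_eq (int_overM intJ_x3q intJ_xq2) _; ring.
have i2 : intJ 2 (vz ^+ 2 * vq ^+ 3) by apply: intJ_z2 => //;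
  apply: (int_overM intJ_g intJ_q3).
apply: intJ_eq (int_overD (intJ_lin 9 (12 * vt) i1 (int_overM intJ_xzq intJ_xq2))
  (int_overMl (4 * vt ^+ 2) i2)) _.
rewrite /vq; ring.
Qed.

(** Since y enters J only through y^5, fifth powers are decomposed: here y^5 (x^3 q)^3 (x q^2). *)
Lemma intJ_yx2q : intJ 1 (vy * vx ^+ 2 * vq).
Proof. apply: intJ_root5 (int_overM (int_overM intJ_y5 (intJ_X 3 intJ_x3q)) intJ_xq2)
  _; ring. Qed.

Lemma intJ_yzq : intJ 1 (vy * vz * vq).
Proof.
have i1 : intJ 1 (vy ^+ 2 * vq ^+ 2).
  apply: intJ_root5 (int_overMl vq (int_overM (intJ_X 2 intJ_y5) (intJ_X 3 intJ_q3)))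
    _; ring.
apply: (intJ_root2 (k := 2) (intJ_lin 1 (- vt) (int_overM intJ_g i1) (intJ_X 2
  intJ_yx2q))).
rewrite /vg; ring.
Qed.

Lemma intJ_x3yz : intJ 1 (vx ^+ 3 * vy * vz).
Proof.
have i1 : intJ 1 (vz ^+ 2 * vx ^+ 3).
  apply: intJ_z2; first by rewrite mulrC; apply: int_overMl intJ_g.
  by apply: intJ_eq (int_overMl vx intJ_x6) _; ring.
apply: intJ_root5 (int_overM (int_overM intJ_y5 (intJ_X 3 intJ_x4z)) i1) _; ring.
Qed.

Lemma intJ_xy2q : intJ 1 (vx * vy ^+ 2 * vq).
Proof.
apply: intJ_root5 (int_overM (int_overM (intJ_X 2 intJ_y5) intJ_x3q) (intJ_X 2
  intJ_xq2)) _; ring.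
Qed.

Lemma intJ_y3q : intJ 1 (vy ^+ 3 * vq).
Proof. apply: intJ_root5 (int_overM (intJ_X 3 intJ_y5) intJ_q5) _; ring. Qed.

Lemma intJ_x4y2 : intJ 1 (vx ^+ 4 * vy ^+ 2).
Proof.
apply: intJ_root5 (int_overMl (vx ^+ 2) (int_overM (intJ_X 2 intJ_y5) (intJ_X 3
  intJ_x6))) _; ring.
Qed.

(* [vr ^+ 2 = vp * vg - 3 * vt * vq ^+ 2] *)
Lemma intJ_xy2r : intJ 1 (vx * vy ^+ 2 * vr).
Proof.
have i1 : intJ 1 (vx ^+ 2 * vy ^+ 4).
  apply: intJ_root5 (int_overMl (vx ^+ 4) (int_overM (intJ_X 4 intJ_y5) intJ_x6)) _; ring.
apply: (intJ_root2 (k := 0) (intJ_lin vp (- 3 * vt) (int_overM intJ_g i1) (intJ_X 2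
  intJ_xy2q))).
rewrite /vg /vp /vr /vq; ring.
Qed.

Lemma intJ_y3r : intJ 1 (vy ^+ 3 * vr).
Proof.
apply: (intJ_root2 (k := 0) (intJ_lin (vp * vy) (- 3 * vt) (int_overM intJ_g intJ_y5)
  (intJ_X 2 intJ_y3q))).
rewrite /vg /vp /vr /vq; ring.
Qed.

Lemma intJ_xy3z : intJ 1 (vx * vy ^+ 3 * vz).
Proof.
apply: intJ_root5 (int_overMl (vx * vz)
  (int_overM (int_overM (intJ_X 3 intJ_y5) intJ_x4z) intJ_z3)) _; ring.
Qed.

Lemma intJ_y4z : intJ 1 (vy ^+ 4 * vz).
Proof.
apply: intJ_root5 (int_overMl (vz ^+ 2) (int_overM (intJ_X 4 intJ_y5) intJ_z3)) _; ring.
Qed.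

Lemma intJ_xy4p : intJ 1 (vx * vy ^+ 4 * vp).
Proof.
have i1 : intJ 1 (vx ^+ 5 * vp).
  apply: intJ_eq (int_overD (intJ_lin 9 (- 6 * vt) intJ_x3q intJ_xzq)
    (int_overMl (4 * vt ^+ 2 * vx) intJ_g)) _.
  rewrite /vg /vp /vq; ring.
apply: intJ_root5 (int_overMl (vp ^+ 4) (int_overM (intJ_X 4 intJ_y5) i1)) _; ring.
Qed.

Lemma Kgens_integral r : r \in Kgens -> intJ 1 r.
Proof.
apply: (mem_seq_nth (x0 := 0) (P := intJ 1)); case=>
  [|[|[|[|[|[|[|[|[|[|[|[|[|[|[|[|//]]]]]]]]]]]]]]]] _ /=.
- by apply: intJ_eq intJ_yzq _; rewrite /vq; ring.
- by apply: intJ_eq intJ_xzq _; rewrite /vq; ring.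
- exact: intJ_g.
- exact: intJ_y4z.
- exact: intJ_x4z.
- exact: intJ_y5.
- by apply: intJ_eq intJ_y3q _; rewrite /vq; ring.
- by apply: intJ_eq intJ_xy2q _; rewrite /vq; ring.
- by apply: intJ_eq (intJ_lin 3 (- 2 * vt) intJ_yx2q intJ_yzq) _; rewrite /vq; ring.
- by apply: intJ_eq intJ_x3q _; rewrite /vq; ring.
- by apply: intJ_eq (int_overMl vt intJ_x3yz) _; ring.
- exact: intJ_x4y2.
- by apply: intJ_eq (intJ_lin (2 * vt ^+ 2) (- 3) intJ_y3q intJ_y3r) _;
    rewrite /vq /vr; ring.
- by apply: intJ_eq (int_overMl (vt ^+ 2) intJ_xy3z) _; ring.
- by apply: intJ_eq intJ_xy2r _; rewrite /vr; ring.
- by apply: intJ_eq intJ_xy4p _; rewrite /vp; ring.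
Qed.

Lemma K_integral r : r \in KK -> integral_over_ideal JJ r.
Proof.
move=> rK; apply: int_over_integral.
apply: (seq_ideal_ind _ _ _ _ rK) => [|a b|a b|a]; first exact: int_over0.
- exact: int_overD.
- exact: int_overMl.
exact: Kgens_integral.
Qed.

(** Replacing y by x y is a chart of the blow-up of x = y = 0: the order in x becomes the total
    order in x and y. *)
Definition phi5 := par CP3 'X ('X * 'X%:P) 'X%:P%:P.
HB.instance Definition _ := GRing.RMorphism.on phi5.

Lemma eval1_CP3 h : eval1 CP3 'X%:P%:P h = h%:P%:P.
Proof.
rewrite /eval1 /= /horner_eval.
rewrite -[h in RHS]comp_polyXr /comp_poly -!horner_map /= -!map_poly_comp.
by congr (_.[_]); apply: eq_map_poly.
Qed.

Lemma phi5_order r : ord_ge 5 (phi5 r) -> order5 r.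
Proof.
move=> /ord_geP r5 k l kl5; have := r5 _ kl5; rewrite /phi5 par_par3.
have [n len [szF szFi _ _]] := poly3_bound (par3 r) (par3 r) (k + l).+1.
move: (par3 r) szF szFi => F szF szFi.
rewrite (eval3E _ _ _ _ szF szFi) => /(congr1 (fun f : {poly {poly rat}} => f`_l)).
have ltk : (k < n)%N by lia.
have ltl : (l < n)%N by lia.
have term (i j : nat) : (eval1 CP3 'X%:P%:P F`_i`_j * 'X ^+ i * ('X * 'X%:P)
  ^+ j)`_(k + l)`_l
   = if (i + j == k + l)%N && (j == l) then F`_i`_j else 0.
  have -> : eval1 CP3 'X%:P%:P F`_i`_j * 'X ^+ i * ('X * 'X%:P) ^+ j
      = ((F`_i`_j)%:P * 'X ^+ j)%:P * 'X ^+ (i + j).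
    by rewrite eval1_CP3 exprMn rmorphM rmorphXn exprD /=; ring.
  rewrite coefCM coefXn [(k + l == _)%N]eq_sym; case: eqP => _ /=; last first.
    by rewrite mulr0 coef0.
  rewrite mulr1 coefCM coefXn eq_sym; case: eqP => _; by rewrite ?mulr1 ?mulr0.
rewrite coef0 => eq0.
have {eq0 term} : \sum_(i < n) \sum_(j < n)
    (if (i + j == k + l)%N && (j == l :> nat) then F`_i`_j else 0) = 0.
  rewrite -[RHS]eq0 !coef_sum; apply: eq_bigr => i _.
  rewrite !coef_sum; apply: eq_bigr => j _; apply: esym; apply: term.
rewrite (bigD1 (Ordinal ltk)) //= [X in _ + X]big1 => [|i ne].
  rewrite addr0 (bigD1 (Ordinal ltl)) //= !eqxx big1 ?addr0 // => j.
  by rewrite -val_eqE => /negPf /= ->; rewrite andbF.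
rewrite big1 // => j _; case: ifP => // /andP[/eqP eq1 /eqP eq2].
by move: ne; rewrite -val_eqE /=; lia.
Qed.

Lemma J_phi5 a : a \in JJ -> ord_ge 5 (phi5 a).
Proof.
apply: ord_ge_rmorph; apply: (mem_seq_nth (x0 := 0) (P := fun b => ord_ge 5 (phi5 b))).
case=> [|[|[|[|//]]]] _ /=.
- by exists 0; rewrite !(rmorphD, rmorphM, rmorph_nat) /= /phi5 !parE; ring.
- by exists ('X * 'X%:P%:P); rewrite !(rmorphD, rmorphM, rmorph_nat) /= /phi5 !parE; ring.
- by exists ('X%:P ^+ 5); rewrite !(rmorphD, rmorphM, rmorph_nat) /= /phi5 !parE; ring.
exists (3 - 6 * 'X%:P%:P ^+ 3).
by rewrite !(rmorphD, rmorphM, rmorph_nat) /= /phi5 !parE; ring.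
Qed.

Lemma J_phi30 a : a \in JJ -> ord_ge 30 (phi30 a).
Proof.
apply: ord_ge_rmorph; apply: (mem_seq_nth (x0 := 0) (P := fun b => ord_ge 30 (phi30 b))).
case=> [|[|[|[|//]]]] _ /=.
- by exists 0; rewrite !(rmorphD, rmorphM, rmorph_nat) /= /phi30 !parE; ring.
- exists (c0%:P + 'X ^+ 5).
  by rewrite !(rmorphD, rmorphM, rmorph_nat) /= /phi30 !parE; ring.
- by exists 1; rewrite !(rmorphD, rmorphM, rmorph_nat) /= /phi30 !parE; ring.
(* The quotient of 3 (1 - 2 u^3) by s^5 at u = c0 + s^5. *)
exists (- 18 * c0%:P ^+ 2 - 18 * c0%:P * 'X ^+ 5 - 6 * 'X ^+ 10).
have c0P : 2 * c0%:P ^+ 3 = 1 :> {poly algC}.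
  by rewrite -[RHS](rmorph1 (@polyC _)) -c0E rmorphM rmorphXn rmorph_nat.
rewrite !(rmorphD, rmorphM, rmorph_nat) /= /phi30 !parE.
transitivity ('X ^+ 25 * (3 * (1 - 2 * c0%:P ^+ 3) + (- 18 * c0%:P ^+ 2 - 18 * c0%:P
  * 'X ^+ 5 - 6 * 'X ^+ 10) * 'X ^+ 5)); first by ring.
by rewrite c0P; ring.
Qed.

Lemma integral_closureJ : integral_closure JJ =i KK.
Proof.
move=> r; apply/asboolP/idP => [ri|]; last exact: K_integral.
have K30 k : k \in KK -> ord_ge 30 (phi30 k).
  by move=> kK; apply: (integral_ord_ge J_phi30); apply: K_integral.
apply: K_of_orders => //.
  by apply: phi5_order; apply: (integral_ord_ge J_phi5).
exact: (integral_ord_ge J_phi30).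
Qed.

(** * Primary decomposition *)

Lemma mderivXn (R : comNzRingType) n (i : 'I_n) (p : {mpoly R[n]}) k :
  mderiv i (p ^+ k) = k%:R * p ^+ k.-1 * mderiv i p.
Proof.
elim: k => [|[|k] IHk]; first by rewrite mul0r mul0r expr0 -mpolyC1 mderivC.
  by rewrite expr0 !mul1r.
by rewrite exprS mderivM IHk /= -[k.+2]addn1 natrD exprS; ring.
Qed.

Lemma mderiv_var (R : comNzRingType) n (i j : 'I_n) :
  mderiv i ('X_j : {mpoly R[n]}) = (i == j)%:R.
Proof.
rewrite mderivX mnm1E eq_sym; case: eqP => [->|_]; last by rewrite scale0r.
rewrite scale1r (_ : (U_(j) - U_(j))%MM = 0%MM) ?mpolyX0 //.
by apply/mnmP=> k; rewrite mnmBE subnn mnm0E.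
Qed.

Lemma enum4 : enum 'I_4 = [:: @Ordinal 4 0 isT; @Ordinal 4 1 isT; @Ordinal 4 2 isT;
  @Ordinal 4 3 isT].
Proof. by apply: (inj_map val_inj); rewrite val_enum_ord. Qed.

(** * Membership in J and absence of torsion over Q[t] *)

Section Membership.
Implicit Types (r : {mpoly rat[4]}) (h : {poly rat}).

Lemma J_coef r A B c : r = ev3 A + vz * ev3 B + c * vg -> r \in JJ ->
  [/\ forall i j, (i < 5)%N -> (j < 5)%N -> A`_i`_j = 0,
      forall i j, (i < 3)%N -> (j < 5)%N -> B`_i`_j = 0
    & forall j, (j < 5)%N -> 3 * B`_3`_j = 2 * 'X * A`_5`_j].
Proof.
move=> def_r rJ.
(* On [g = 0], modulo [(x^6, y^5)], an element of [J] is a sum of [x^5 (3 - 6 u^3) y^j] *)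
(* with coefficients in [Q[t]], that is, in [Q[u^2]].                             *)
pose P (F : poly3) := exists D : nat -> {poly rat}, forall i j, (i < 6)%N -> (j < 5)%N ->
  F`_i`_j = if i == 5%N then (D j \Po w3) * (3 - 6 * 'X ^+ 3) else 0.
have PJ : P (par3 r).
  case/seq_idealW: rJ => s sJ ->; rewrite rmorph_sum big_seq /=.
  elim/big_ind: _ => [|F G [D HD] [D' HD']|p /sJ].
  - by exists (fun=> 0) => i j _ _; rewrite !coef0 comp_poly0 mul0r if_same.
  - exists (fun j => D j + D' j) => i j lti ltj; rewrite !coefD HD ?HD' //.
    by case: ifP => _; rewrite ?addr0 //= comp_polyD -mulrDl.
  move: p.1 p.2 => a b; rewrite rmorphM /=; move: b.
  apply: (mem_seq_nth (x0 := 0) (P := fun b => P (par3 a * par3 b))).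
  case=> [|[|[|[|//]]]] _ /=.
  - exists (fun=> 0) => i j _ _; rewrite comp_poly0 mul0r if_same.
    have -> : par3 (vx ^+ 4 * vt + 3 * vz ^+ 2) = 0.
      by rewrite /par3 !(rmorphD, rmorphM, rmorph_nat) /= !parE; ring.
    by rewrite mulr0 !coef0.
  - exists (fun=> 0) => i j lti _; rewrite comp_poly0 mul0r if_same.
    have -> : par3 (vx ^+ 4 * vz) = 'X%:P%:P * 'X ^+ 6.
      by rewrite /par3 !(rmorphM, rmorph_nat) /= !parE; ring.
    by rewrite mulrA coefMXn lti coef0.
  - exists (fun=> 0) => i j _ ltj; rewrite comp_poly0 mul0r if_same.
    have -> : par3 (vy ^+ 5) = ('X ^+ 5)%:P.
      by rewrite /par3 !(rmorphM, rmorph_nat) /= !parE; ring.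
    by rewrite coefMC coefMXn ltj.
  have -> : par3 (3 * vx ^+ 5 + 2 * vx ^+ 3 * vz * vt) = (3 - 6 * 'X ^+ 3)%:P%:P * 'X
    ^+ 5.
    have -> : (3 - 6 * 'X ^+ 3)%:P%:P = 3 - 6 * 'X%:P%:P ^+ 3 :> poly3.
      by rewrite rmorphB rmorphM !rmorph_nat rmorphB rmorphM !rmorph_nat !rmorphXn.
    rewrite /par3 rmorphD !(rmorphM (par _ _ _ _)) !rmorph_nat /= !parE; ring.
  (* Multiplied by x^5, only the part of the cofactor of degree 0 in x matters modulo x^6, and z B'
     starts at x^2. *)
  have [A' [B' [c' ->]]] := decompose a.
  exists (fun j => A'`_0`_j) => i j lti ltj; rewrite mulrA coefMXn.
  case: eqP => [->|ne5]; last by rewrite ifT ?coef0 //; lia.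
  by rewrite !coefMC coef_par3_decompose /= comp_poly0 mulr0 addr0.
have [D HD] := PJ.
have c0 i j : (i < 5)%N -> (j < 5)%N -> A`_i`_j = 0 /\ shift2 B i j = 0.
  move=> lti ltj; apply: comp_w3_eq0; rewrite -(coef_par3_decompose A B c) -def_r.
  by rewrite HD ?ifN //; lia.
split=> [i j lti ltj|i j lti ltj|j ltj]; first by case: (c0 i j).
  by have [] := c0 i.+2 j _ ltj.
have := HD 5 j isT ltj; rewrite def_r coef_par3_decompose /= => eq5.
(* Since - 6 u^3 = u (2 t), the even and odd parts of D (3 - 6 u^3) are 3 D and 2 t D. *)
have [/eqP] : A`_5`_j - 3 * D j = 0 /\ B`_3`_j - 2 * 'X * D j = 0.
  apply: comp_w3_eq0; rewrite !rmorphB !(rmorphM (comp_poly w3)) !rmorph_nat /=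
    comp_polyX.
  rewrite mulrBr addrACA eq5 /w3; ring.
by rewrite subr_eq0 => /eqP-> /eqP; rewrite subr_eq0 => /eqP->; ring.
Qed.

Lemma J_of_coef r A B c : r = ev3 A + vz * ev3 B + c * vg ->
  [/\ forall i j, (i < 5)%N -> (j < 5)%N -> A`_i`_j = 0,
      forall i j, (i < 3)%N -> (j < 5)%N -> B`_i`_j = 0
    & forall j, (j < 5)%N -> 3 * B`_3`_j = 2 * 'X * A`_5`_j] -> r \in JJ.
Proof.
move=> def_r [A0 B0 AB]; have [J0 JD JM] := idealJ.
have Jy i : (5 <= i)%N -> vy ^+ i \in JJ.
  by move=> /subnK <-; rewrite exprD; apply: (JM); apply: J_y5.
have iA : ev3 A * 1 - \sum_(0 <= j < 5) ev1 A`_5`_j * vx ^+ 5 * vy ^+ j * 1 \in JJ.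
  apply: (@eval3_rows _ _ _ _ (fun=> 5%N) idealJ) => i j ij; rewrite mulr1.
  have [/Jy|ltj] := leqP 5 j; first exact: JM.
  have [lt5|ge5] := ltnP i 5; first by rewrite A0 // rmorph0 !mul0r.
  rewrite mulrAC; apply: (JM).
  by rewrite -(@subnK 6 i) ?exprD; [apply: (JM); apply: J_x6 | lia].
have iB : ev3 B * vz - \sum_(0 <= j < 5) ev1 B`_3`_j * vx ^+ 3 * vy ^+ j * vz \in JJ.
  apply: (@eval3_rows _ _ _ _ (fun=> 3%N) idealJ) => i j ij.
  have [/Jy yj|ltj] := leqP 5 j; first by rewrite mulrAC; apply: (JM).
  have [lt3|ge3] := ltnP i 3; first by rewrite B0 // rmorph0 !mul0r.
  have -> : vx ^+ i = vx ^+ (i - 4) * vx ^+ 4 by rewrite -exprD subnK //; lia.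
  by apply: mem_eq (JM (ev1 B`_i`_j * vx ^+ (i - 4) * vy ^+ j) _ J_x4z) _; ring.
have iAB : \sum_(0 <= j < 5) (ev1 A`_5`_j * vx ^+ 5 * vy ^+ j * 1
     + ev1 B`_3`_j * vx ^+ 3 * vy ^+ j * vz) \in JJ.
  rewrite big_nat_cond; apply: ideal_sum => [|j /[!andbT] /andP[_ ltj]].
    exact: idealJ.
  apply: (ideal_natl (k := 2) idealJ).
  apply: mem_eq (JM (ev1 A`_5`_j * vy ^+ j) _ J_x3q) _.
  have := congr1 (fun h => ev1 h) (AB _ ltj).
  rewrite !rmorphM !rmorph_nat /= eval1X /vq => eqAB.
  transitivity (3 * ev1 A`_5`_j * vx ^+ 5 * vy ^+ j
    + (3 * ev1 B`_3`_j) * (vx ^+ 3 * vy ^+ j * vz)); first by ring.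
  by rewrite eqAB; ring.
move: iAB; rewrite big_split /= => iAB.
apply: mem_eq (JD _ _ (JD _ _ (JD _ _ iA iB) iAB) (JM c _ J_g)) _.
rewrite def_r; ring.
Qed.

(** The criterion of [J_coef] and [J_of_coef] is linear over the domain Q[t], so h can be
    cancelled. *)
Lemma J_torsionfree h r : h != 0 -> ev1 h * r \in JJ -> r \in JJ.
Proof.
move=> h0; have [A [B [c def_r]]] := decompose r.
have def_hr : ev1 h * r = ev3 (h%:P%:P * A) + vz * ev3 (h%:P%:P * B) + (ev1 h * c) * vg.
  by rewrite def_r !rmorphM /= eval3C; ring.
move=> /(J_coef def_hr)[A0 B0 AB]; apply: J_of_coef def_r _.
split=> [i j lti ltj|i j lti ltj|j ltj]; apply: (mulfI h0).
- by have := A0 i j lti ltj; rewrite !coefCM mulr0.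
- by have := B0 i j lti ltj; rewrite !coefCM mulr0.
- by have := AB j ltj; rewrite !coefCM => e; rewrite mulrCA e; ring.
Qed.
End Membership.

(** * The two primes and the associated primes of K *)

Definition P0 : {pred {mpoly rat[4]}} := seq_ideal (R := {mpoly rat[4]}) [:: vz; vy; vx].
Definition P1 : {pred {mpoly rat[4]}} :=
  seq_ideal (R := {mpoly rat[4]}) [:: vz; vy; vx; 4 * vt ^+ 3 + 27].

Lemma idealP0 : ideal_pred P0. Proof. exact: ideal_gen_ideal. Qed.
Lemma idealP1 : ideal_pred P1. Proof. exact: ideal_gen_ideal. Qed.

Lemma P0_x : vx \in P0. Proof. cert 0 [:: 0; 0; 1]. Qed.
Lemma P0_y : vy \in P0. Proof. cert 0 [:: 0; 1]. Qed.
Lemma P0_z : vz \in P0. Proof. cert 0 [:: 1]. Qed.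
Lemma P1_x : vx \in P1. Proof. cert 0 [:: 0; 0; 1]. Qed.
Lemma P1_y : vy \in P1. Proof. cert 0 [:: 0; 1]. Qed.
Lemma P1_z : vz \in P1. Proof. cert 0 [:: 1]. Qed.
Lemma P1_p : vp \in P1. Proof. cert 0 [:: 0; 0; 0; 1]. Qed.

Lemma P0_mul_min (I : {pred {mpoly rat[4]}}) m : ideal_pred I ->
  vx * m \in I -> vy * m \in I -> vz * m \in I -> forall n, n \in P0 -> n * m \in I.
Proof.
move=> [I0 ID IM] Ix Iy Iz; apply: (@seq_ideal_ind _ _ (fun n => n * m \in I)).
- by rewrite mul0r.
- by move=> a b aI bI; rewrite mulrDl; apply: ID.
- by move=> a b bI; rewrite -mulrA; apply: IM.
by apply: (mem_seq_nth (x0 := 0) (P := fun n => n * m \in I)); case=> [|[|[|//]]].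
Qed.

Lemma P1_mul_min (I : {pred {mpoly rat[4]}}) m : ideal_pred I ->
  vx * m \in I -> vy * m \in I -> vz * m \in I -> vp * m \in I ->
  forall n, n \in P1 -> n * m \in I.
Proof.
move=> [I0 ID IM] Ix Iy Iz Ip; apply: (@seq_ideal_ind _ _ (fun n => n * m \in I)).
- by rewrite mul0r.
- by move=> a b aI bI; rewrite mulrDl; apply: ID.
- by move=> a b bI; rewrite -mulrA; apply: IM.
by apply: (mem_seq_nth (x0 := 0) (P := fun n => n * m \in I)); case=> [|[|[|[|//]]]].
Qed.

Lemma P0_min (I : {pred {mpoly rat[4]}}) :
  ideal_pred I -> vx \in I -> vy \in I -> vz \in I -> {subset P0 <= I}.
Proof.
by move=> iI Ix Iy Iz n /(P0_mul_min (m := 1) iI); rewrite !mulr1; apply.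
Qed.

Lemma P1_min (I : {pred {mpoly rat[4]}}) :
  ideal_pred I -> vx \in I -> vy \in I -> vz \in I -> vp \in I -> {subset P1 <= I}.
Proof.
by move=> iI Ix Iy Iz Ip n /(P1_mul_min (m := 1) iI); rewrite !mulr1; apply.
Qed.

Lemma P0_split r : exists h n, r = ev1 h + n /\ n \in P0.
Proof.
have [P00 PD PM] := idealP0.
elim/mpoly4_ind: r => [k|_ _ [h [n [-> nP]]] [h' [n' [-> nP']]]
    |p _|p _|p _|_ [h [n [-> nP]]]].
- by exists k%:P, 0; rewrite eval1C addr0.
- by exists (h + h'), (n + n'); rewrite rmorphD /= addrACA; split=> //; apply: PD.
- by exists 0, (vx * p); rewrite rmorph0 add0r mulrC; split=> //; apply: (PM);
    apply: P0_x.
- by exists 0, (vy * p); rewrite rmorph0 add0r mulrC; split=> //; apply: (PM);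
    apply: P0_y.
- by exists 0, (vz * p); rewrite rmorph0 add0r mulrC; split=> //; apply: (PM);
    apply: P0_z.
by exists ('X * h), (vt * n); rewrite rmorphM /= eval1X mulrDr; split=> //; apply: PM.
Qed.

Lemma order5_K k : k \in KK -> order5 k.
Proof.
by move=> kK; apply: phi5_order; apply: (integral_ord_ge J_phi5); apply: K_integral.
Qed.

Lemma ord30_K k : k \in KK -> ord_ge 30 (phi30 k).
Proof. by move=> kK; apply: (integral_ord_ge J_phi30); apply: K_integral. Qed.

Lemma par3_ev1 h : par3 (ev1 h) = (h \Po w3)%:P%:P.
Proof.
apply/polyP=> i; apply/polyP=> j.
have := coef_par3_eval3 h%:P%:P i j; rewrite eval3C => ->.
rewrite !coefC; case: (i == 0%N); rewrite ?coef0 ?comp_poly0 //.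
by rewrite !coefC; case: ifP; rewrite ?comp_poly0.
Qed.

Lemma comp_w3_inj0 h : h \Po w3 = 0 -> h = 0.
Proof.
by move=> h0; case: (@comp_w3_eq0 h 0) => //; rewrite h0 comp_poly0 mulr0 addr0.
Qed.

(** On the surface h becomes a nonzero element of the domain Q[u], so r itself has order 5. *)
Lemma K_torsion h r : h != 0 -> ev1 h * r \in KK -> vp * r \in KK.
Proof.
move=> h0 /order5_K hr5; apply: order5_pK => i j ij; have := hr5 i j ij.
rewrite rmorphM /= par3_ev1 !coefCM => /eqP; rewrite mulf_eq0 =>
  /orP[/eqP/comp_w3_inj0|/eqP//].
by move/eqP; rewrite (negPf h0).
Qed.

(** The monomial y^4 has order 4 < 5, so its class modulo K is torsion free. *)
Lemma ev1_y4_K h : ev1 h * vy ^+ 4 \in KK -> h = 0.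
Proof.
move=> /order5_K/(_ 0%N 4 isT); rewrite rmorphM rmorphXn /= par3_ev1.
have -> : par3 vy = 'X%:P by rewrite /par3 par_y.
have -> : 'X%:P ^+ 4 = ('X ^+ 4)%:P :> poly3 by rewrite rmorphXn.
by rewrite coefCM coefC /= coefCM coefXn /= mulr1; apply: comp_w3_inj0.
Qed.

Lemma ev1_xy4_K h : ev1 h * (vx * vy ^+ 4) \in KK -> (map_poly ratr h).[t0] = 0.
Proof.
rewrite mulrA -[vx]expr1 => /ord30_K; rewrite phi30_monomial.
have [k ->] := phi30_ev1 h => /ord_geP/(_ 29 isT).
by rewrite coefMXn coefD coefC coefXnM /= addr0.
Qed.

Lemma K_y4z : vy ^+ 4 * vz \in KK. Proof. cert 0 [:: 0; 0; 0; 1]. Qed.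

(** The factor p is there because x y^4 lies outside K whereas p x y^4 is in it. *)
Lemma P0_ann r : (r \in P0) = (r * (vp * vy ^+ 4) \in KK).
Proof.
have [_ KD KM] := idealK.
have P0K n : n \in P0 -> n * (vp * vy ^+ 4) \in KK.
  apply: (P0_mul_min idealK).
  - by rewrite mulrCA; apply: K_pxy4.
  - by rewrite mulrCA -exprS; apply: (KM); apply: K_y5.
  - by rewrite mulrC -mulrA; apply: (KM); apply: K_y4z.
apply/idP/idP => [/P0K //|]; have [h [n [-> nP]]] := P0_split r.
rewrite mulrDl => rK; have := idealB idealK rK (P0K _ nP); rewrite addrK.
rewrite mulrA -ev1_pQ -rmorphM => /ev1_y4_K/eqP; rewrite mulf_eq0 (negPf pQ_neq0).
rewrite orbF => /eqP->; rewrite rmorph0 add0r; exact: nP.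
Qed.

Lemma P1_ann r : (r \in P1) = (r * (vx * vy ^+ 4) \in KK).
Proof.
have [_ KD KM] := idealK; have [_ PD PM] := idealP1.
have P1K n : n \in P1 -> n * (vx * vy ^+ 4) \in KK.
  apply: (P1_mul_min idealK).
  - by rewrite mulrA -expr2; apply: (@K_mon 2 4).
  - by rewrite mulrCA -exprS; apply: (KM); apply: K_y5.
  - by rewrite mulrC -mulrA; apply: (KM); apply: K_y4z.
  - exact: K_pxy4.
apply/idP/idP => [/P1K //|]; have [h [n [-> nP0]]] := P0_split r.
have nP : n \in P1 by apply: P0_min nP0; rewrite ?P1_x ?P1_y ?P1_z //; apply: idealP1.
rewrite mulrDl => rK; have := idealB idealK rK (P1K _ nP); rewrite addrK.
move/ev1_xy4_K/root_t0/dvdpP => [q ->]; apply: (PD); last exact: nP.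
rewrite rmorphM /= ev1_pQ; apply: (PM); exact: P1_p.
Qed.

Lemma P0E h n : n \in P0 -> (ev1 h + n \in P0) = (h == 0).
Proof.
have [P00 PD _] := idealP0.
move=> nP; apply/idP/eqP => [hn|->]; last by rewrite rmorph0 add0r.
have := idealB idealP0 hn nP; rewrite addrK P0_ann mulrA -ev1_pQ -rmorphM =>
  /ev1_y4_K/eqP.
rewrite mulf_eq0 (negPf pQ_neq0).
by rewrite orbF => /eqP.
Qed.

Lemma P1E h n : n \in P0 -> (ev1 h + n \in P1) = (root (map_poly ratr h) t0).
Proof.
have [_ PD PM] := idealP1.
move=> nP0; have nP : n \in P1.
  by apply: P0_min nP0; rewrite ?P1_x ?P1_y ?P1_z //; apply: idealP1.
apply/idP/rootP => [hn|/root_t0/dvdpP[q ->]].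
  by have := idealB idealP1 hn nP; rewrite addrK P1_ann => /ev1_xy4_K.
apply: (PD); last exact: nP.
rewrite rmorphM /= ev1_pQ; apply: (PM); exact: P1_p.
Qed.

Lemma split_mul a b n n' : n \in P0 -> n' \in P0 ->
  exists2 m, m \in P0 & (ev1 a + n) * (ev1 b + n') = ev1 (a * b) + m.
Proof.
move=> nP nP'; have [_ PD PM] := idealP0.
exists (ev1 a * n' + (ev1 b + n') * n); first by apply: (PD); apply: (PM).
by rewrite rmorphM /=; ring.
Qed.

Lemma idealr_closed_ideal (R : comNzRingType) (I : {pred R}) :
  ideal_pred I -> 1 \notin I -> idealr_closed I.
Proof. by move=> [I0 ID IM] I1; split=> // a u v uI vI; apply: ID => //; apply: IM. Qed.

Lemma P0_prime : prime_ideal P0.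
Proof.
split.
  apply: (idealr_closed_ideal idealP0); rewrite -[1]addr0 -(rmorph1 ev1) P0E
    ?oner_neq0 //.
  by case: idealP0.
move=> u v; have [a [n [-> nP]]] := P0_split u; have [b [n' [-> nP']]] := P0_split v.
by have [m mP ->] := split_mul a b nP nP'; rewrite !P0E // mulf_eq0.
Qed.

Lemma P1_prime : prime_ideal P1.
Proof.
split.
  apply: (idealr_closed_ideal idealP1); rewrite -[1]addr0 -(rmorph1 ev1) P1E.
    by rewrite rmorph1 rootE hornerC oner_neq0.
  by case: idealP0.
move=> u v; have [a [n [-> nP]]] := P0_split u; have [b [n' [-> nP']]] := P0_split v.
by have [m mP ->] := split_mul a b nP nP'; rewrite !P1E // rmorphM rootM.
Qed.

Lemma prime_ideal_ext (R : comNzRingType) (I I' : {pred R}) :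
  I =i I' -> prime_ideal I' -> prime_ideal I.
Proof.
move=> eqI [[I0 I1 IL] IP]; split; last by move=> u v; rewrite !eqI; apply: IP.
by split; rewrite ?eqI // => a u v; rewrite !eqI; apply: IL.
Qed.

Lemma prime_ideal_pred (R : comNzRingType) (I : {pred R}) :
  prime_ideal I -> ideal_pred I.
Proof.
case=> -[I0 I1 IL] _; split=> // a b; last by move=> bI; rewrite -[_ * _]addr0 IL.
by move=> aI bI; rewrite -[a]mul1r IL.
Qed.

Lemma prime_idealX (R : comNzRingType) (I : {pred R}) (a : R) k :
  prime_ideal I -> a ^+ k \in I -> a \in I.
Proof.
case=> -[I0 I1 IL] IP; elim: k => [|k IHk]; first by rewrite expr0 (negPf I1).
by rewrite exprS => /IP/orP[].
Qed.

Lemma K_x6 : vx ^+ 6 \in KK. Proof. by have := @K_mon 6 0 isT; rewrite mulr1. Qed.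
Lemma K_z3 : vz ^+ 3 \in KK. 
Proof. cert 2 [:: 0; 0; vz; 0; - vt]. Qed.

(** Powers of x, y, z lie in K, so P is determined by its trace on Q[t]. A nonzero trace contains p
    by [K_torsion], and an element of P outside [P1] would then give 1 by Bezout. *)
Lemma K_associated P : associated_prime KK P <-> P =i P0 \/ P =i P1.
Proof.
split=> [[prP [m annP]]|[eqP|eqP]]; first last.
- split; first exact: prime_ideal_ext eqP P1_prime.
  by exists (vx * vy ^+ 4) => r; rewrite eqP P1_ann inE.
- split; first exact: prime_ideal_ext eqP P0_prime.
  by exists (vp * vy ^+ 4) => r; rewrite eqP P0_ann inE.
have iP := prime_ideal_pred prP; have [_ PD PM] := iP; have [_ _ KM] := idealK.
have inP r : (r \in P) = (r * m \in KK) by rewrite annP inE.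
have KP r : r \in KK -> r \in P by move=> rK; rewrite inP mulrC; apply: KM.
have Px : vx \in P by apply: (prime_idealX prP (KP _ K_x6)).
have Py : vy \in P by apply: (prime_idealX prP (KP _ K_y5)).
have Pz : vz \in P by apply: (prime_idealX prP (KP _ K_z3)).
have P0P := P0_min iP Px Py Pz.
have [[h [h0 hP]]|noh] := pselect (exists h, h != 0 /\ ev1 h \in P).
  right=> r; have pP : vp \in P by move: hP; rewrite !inP; apply: K_torsion.
  apply/idP/idP; last exact: (P1_min iP Px Py Pz pP).
  have [a [n [-> nP]]] := P0_split r => rP.
  have aP : ev1 a \in P by have := idealB iP rP (P0P _ nP); rewrite addrK.
  rewrite P1E //; apply/negPn/negP => na.
  have co : coprimep pQ a.
    apply: coprime_pQ; apply: contra na => /dvdpP[h' ->].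
    by rewrite rmorphM rootM [root (map_poly _ pQ) _]rootE root_pQ eqxx orbT.
  have /Bezout_eq1_coprimepP[[u v] /= /(congr1 (fun q => ev1 q))] := co.
  rewrite rmorphD !rmorphM rmorph1 /= ev1_pQ => eq1.
  have : 1 \in P by rewrite -eq1; apply: (PD); apply: (PM).
  by case: prP => -[_ /negPf ->].
left=> r; apply/idP/idP; last exact: P0P.
have [a [n [-> nP]]] := P0_split r => rP; rewrite P0E //.
apply/negPn/negP => a0; apply: noh; exists a; split=> //.
by have := idealB iP rP (P0P _ nP); rewrite addrK.
Qed.

(** The product p x y^4 is in K, but x y^4 is not, and no power of p is since y^4 is torsion
    free. *)
Lemma K_not_primary : ~ primary_ideal KK.
Proof.
case=> _ /(_ (vx * vy ^+ 4) vp); rewrite mulrC => /(_ K_pxy4)[|[n]].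
  rewrite -[X in X \in _]mul1r -(rmorph1 ev1) => /ev1_xy4_K/eqP.
  by rewrite rmorph1 hornerC oner_eq0.
have [_ _ KM] := idealK.
rewrite -ev1_pQ -rmorphXn => /(KM (vy ^+ 4)); rewrite mulrC => /ev1_y4_K/eqP.
by rewrite expf_eq0 (negPf pQ_neq0) andbF.
Qed.

Lemma P0_nilpotent n : n \in P0 -> exists k, n ^+ k \in JJ.
Proof.
have [J0 JD JM] := idealJ.
apply: (@seq_ideal_ind _ _ (fun n => exists k, n ^+ k \in JJ)).
- by exists 1%N; rewrite expr1.
- by move=> a b [k ak] [l bl]; exists (k + l)%N; apply: (ideal_add_exp idealJ).
- by move=> a b [k bk]; exists k; rewrite exprMn; apply: JM.
apply: (mem_seq_nth (x0 := 0) (P := fun n => exists k, n ^+ k \in JJ)).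
case=> [|[|[|//]]] _ /=; first by exists 3; apply: J_z3.
  by exists 5%N; apply: J_y5.
by exists 6%N; apply: J_x6.
Qed.

Lemma J_primary : primary_ideal JJ.
Proof.
have [J0 JD JM] := idealJ; split.
  apply: (idealr_closed_ideal idealJ); apply/negP => /J_phi5/ord_geP/(_ 0%N isT).
  by rewrite rmorph1 coef1 => /eqP; rewrite oner_eq0.
move=> a b; have [h [n [-> /P0_nilpotent nP]]] := P0_split b => abJ.
have [->|h0] := eqVneq h 0; first by right; rewrite rmorph0 add0r.
(* With b = h + n and n^k in J, the difference h^k - (- n)^k is a multiple of b, so h^k a lies in
   J. *)
left; have [k nk] := nP; apply: (@J_torsionfree (h ^+ k)); first by rewrite expf_neq0.
have nNk : (- n) ^+ k \in JJ by rewrite exprNn; apply: JM.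
rewrite rmorphXn /= -[_ ^+ k](subrK ((- n) ^+ k)) mulrDl; apply: (JD).
  rewrite subrXX opprK mulrAC mulrC.
  by rewrite [_ * a]mulrC; apply: JM.
by rewrite mulrC; apply: JM.
Qed.

Lemma seq_ideal_sub (R : comNzRingType) (s u : seq R) :
  (forall i, (i < size s)%N -> s`_i \in seq_ideal u) ->
  {subset seq_ideal s <= seq_ideal u}.
Proof.
move=> su; have [I0 ID IM] := ideal_gen_ideal (mem u); apply: seq_ideal_ind => //.
exact: (mem_seq_nth (x0 := 0)).
Qed.

Lemma J_jacobian :
  JJ =i jacobian_ideal (vx ^+ 6 + vy ^+ 6 + vx ^+ 4 * vz * vt + vz ^+ 3).
Proof.
have -> : jacobian_ideal (vx ^+ 6 + vy ^+ 6 + vx ^+ 4 * vz * vt + vz ^+ 3)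
  = seq_ideal [:: 6 * vx ^+ 5 + 4 * vx ^+ 3 * vz * vt; 6 * vy ^+ 5;
       vx ^+ 4 * vt + 3 * vz ^+ 2; vx ^+ 4 * vz].
  rewrite /jacobian_ideal enum4 /=; congr (seq_ideal [:: _; _; _; _]);
    rewrite !(mderivD, mderivM, mderivXn) !mderiv_var /=; ring.
move=> r; apply/idP/idP; apply: seq_ideal_sub; case=> [|[|[|[|//]]]] _ /=.
- cert 0 [:: 0; 0; 1].
- cert 0 [:: 0; 0; 0; 1].
- cert 5 [:: 0; 1].
- cert 1 [:: 1].
- cert 0 [:: 0; 0; 0; 2].
- cert 0 [:: 0; 0; 6].
- cert 0 [:: 1].
- cert 0 [:: 0; 1].
Qed.

Lemma primary_ideal_ext (R : comNzRingType) (I I' : {pred R}) :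
  I =i I' -> primary_ideal I -> primary_ideal I'.
Proof.
move=> eqI [[I0 I1 IL] IP]; split.
  by split; rewrite -?eqI // => a u v; rewrite -!eqI; apply: IL.
move=> a b abI'; have abI : a * b \in I by rewrite eqI.
by case: (IP _ _ abI) => [aI|[n bI]]; [left | right; exists n]; rewrite -eqI.
Qed.

Lemma associated_prime_ext (R : comNzRingType) (I I' P : {pred R}) :
  I =i I' -> associated_prime I P -> associated_prime I' P.
Proof.
by move=> eqI [prP [m annP]]; split=> //; exists m => r; rewrite annP !inE eqI.
Qed.

Theorem mainTheorem3 :
  let x : {mpoly rat[4]} := 'X_(@Ordinal 4 0 isT) in
  let y : {mpoly rat[4]} := 'X_(@Ordinal 4 1 isT) in
  let z : {mpoly rat[4]} := 'X_(@Ordinal 4 2 isT) in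
  let t : {mpoly rat[4]} := 'X_(@Ordinal 4 3 isT) in
  let f := x ^+ 6 + y ^+ 6 + x ^+ 4 * z * t + z ^+ 3 in
  let J := seq_ideal
    [:: x ^+ 4 * t + 3 * z ^+ 2; x ^+ 4 * z; y ^+ 5;
        3 * x ^+ 5 + 2 * x ^+ 3 * z * t] in
  [/\ J =i jacobian_ideal f,
      primary_ideal J,
      integral_closure J =i seq_ideal
        [:: 3 * x ^+ 2 * y * z + 2 * y * z ^+ 2 * t;
            3 * x ^+ 3 * z + 2 * x * z ^+ 2 * t;
            x ^+ 4 * t + 3 * z ^+ 2;
            y ^+ 4 * z;
            x ^+ 4 * z;
            y ^+ 5;
            3 * x ^+ 2 * y ^+ 3 + 2 * y ^+ 3 * z * t;
            3 * x ^+ 3 * y ^+ 2 + 2 * x * y ^+ 2 * z * t;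
            9 * x ^+ 4 * y - 4 * y * z ^+ 2 * t ^+ 2;
            3 * x ^+ 5 + 2 * x ^+ 3 * z * t;
            x ^+ 3 * y * z * t;
            x ^+ 4 * y ^+ 2;
            4 * y ^+ 3 * z * t ^+ 3 + 27 * y ^+ 3 * z;
            x * y ^+ 3 * z * t ^+ 2;
            2 * x ^+ 3 * y ^+ 2 * t ^+ 2 - 9 * x * y ^+ 2 * z;
            4 * x * y ^+ 4 * t ^+ 3 + 27 * x * y ^+ 4],
      ~ primary_ideal (integral_closure J)
    & forall P : {pred {mpoly rat[4]}},
        associated_prime (integral_closure J) P <->
        P =i seq_ideal [:: z; y; x] \/
        P =i seq_ideal [:: z; y; x; 4 * t ^+ 3 + 27]].
Proof.
move=> x y z t f J; have eqK : integral_closure J =i KK := integral_closureJ.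
split; [exact: J_jacobian | exact: J_primary | exact: eqK | |].
  by move/(primary_ideal_ext eqK); apply: K_not_primary.
move=> P; split=> [/(associated_prime_ext eqK)/K_associated //|/K_associated].
by apply: associated_prime_ext => r; rewrite eqK.
Qed.
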